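(* Let $n,m\ge 0$ be integers. Let $A$ and $B$ be infinite virtually abelian finitely generated groups, with growth degrees $a$ and $b$ respectively. Then the following are equivalent: (i) the following three (mutually equivalent) assertions hold: $\mathsf{Shuffler}^{\circ n}(A)$ and $\mathsf{Shuffler}^{\circ m}(B)$ are quasi-isometric; $n=m$ and $a=b$; $\mathsf{Shuffler}^{\circ n}(A)$ and $\mathsf{Shuffler}^{\circ m}(B)$ are biLipschitz equivalent; (ii) there exist a regular map from $\mathsf{Shuffler}^{\circ n}(A)$ to $\mathsf{Shuffler}^{\circ m}(B)$ and a regular map from $\mathsf{Shuffler}^{\circ m}(B)$ to $\mathsf{Shuffler}^{\circ n}(A)$.
   Context: Lampshuffler: $\mathsf{Shuffler}(H)=\mathsf{FSym}(H)\rtimes H$, where $\mathsf{FSym}(H)$ is the group of finitely supported bijections $H\to H$ and $H$ acts by $(h\cdot\sigma)(x)=h\sigma(h^{-1}x)$. Iterates: $\mathsf{Shuffler}^{\circ 0}(H)=H$ and $\mathsf{Shuffler}^{\circ n}(H)=\mathsf{Shuffler}(\mathsf{Shuffler}^{\circ(n-1)}(H))$ for $n\ge 1$. Finitely generated groups are endowed with word metrics associated to finite generating sets. A map $f\colon X\to Y$ between metric spaces is regular if it is $C$-Lipschitz for some $C>0$ and there is $m\ge 1$ such that $|f^{-1}(\{y\})|\le m$ for all $y\in Y$. A biLipschitz equivalence is a bijective quasi-isometry between finitely generated groups. The growth degree is the degree of polynomial volume growth. *)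

(* Defs.v *)
From HB Require Import structures.
From mathcomp Require Import all_boot all_order all_algebra.
From mathcomp Require Import boolp classical_sets functions cardinality reals.

Set Implicit Arguments.
Unset Strict Implicit.
Unset Printing Implicit Defensive.

Import Order.TTheory GRing.Theory Num.Theory.

Local Open Scope classical_set_scope.
Local Open Scope group_scope.

(* The inverse is stored, but it is determined by the underlying function,
   see [fsymP]. *)
Record FSym (T : Type) := MkFSym {
  fsym_fun :> T -> T;
  fsym_inv : T -> T;
  fsym_funK : cancel fsym_fun fsym_inv;
  fsym_invK : cancel fsym_inv fsym_fun;
  fsym_finite : finite_set [set x | fsym_fun x <> x]
}.

Lemma fsymP (T : Type) (s t : FSym T) : s =1 t -> s = t.
Proof.
case: s t => [f f' fK f'K ff] [g g' gK g'K fg] /= /funext fg_eq; subst g.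
have f'g' : f' = g' by apply/funext => x; rewrite -{1}[x]g'K fK.
by subst g'; congr MkFSym; exact: Prop_irrelevance.
Qed.

HB.instance Definition _ (T : Type) := gen_eqMixin (FSym T).
HB.instance Definition _ (T : Type) := gen_choiceMixin (FSym T).

Section FSymGroup.
Variable T : Type.
Implicit Types s t : FSym T.

Fact fsym_one_finite : finite_set [set x : T | id x <> x].
Proof. by apply: sub_finite_set (finite_set0 _) => x /=. Qed.

Definition fsym_one : FSym T :=
  MkFSym (fun=> erefl) (fun=> erefl) fsym_one_finite.

Fact fsym_mul_finite s t : finite_set [set x | (s \o t) x <> x].
Proof.
apply: (@sub_finite_set _ _ ([set x | s x <> x] `|` [set x | t x <> x])).
  move=> x /= stx; have [tx|] := pselect (t x = x); last by right.
  by left; rewrite -{1}tx.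
by rewrite finite_setU; split; exact: fsym_finite.
Qed.

Definition fsym_mul s t : FSym T :=
  MkFSym (can_comp (fsym_funK s) (fsym_funK t))
         (can_comp (fsym_invK t) (fsym_invK s)) (fsym_mul_finite s t).

Fact fsym_inv_finite s : finite_set [set x | fsym_inv s x <> x].
Proof.
apply: sub_finite_set (fsym_finite s) => x /= sx sxx; apply: sx.
by rewrite -{1}sxx fsym_funK.
Qed.

Definition fsym_invg s : FSym T :=
  MkFSym (fsym_invK s) (fsym_funK s) (fsym_inv_finite s).

Fact fsym_mulA : associative fsym_mul.
Proof. by move=> s t u; exact: fsymP. Qed.
Fact fsym_mul1 : left_id fsym_one fsym_mul.
Proof. by move=> s; exact: fsymP. Qed.
Fact fsym_1mul : right_id fsym_one fsym_mul.
Proof. by move=> s; exact: fsymP. Qed.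
Fact fsym_mulV : left_inverse fsym_one fsym_invg fsym_mul.
Proof. by move=> s; apply: fsymP => x /=; rewrite fsym_funK. Qed.
Fact fsym_Vmul : right_inverse fsym_one fsym_invg fsym_mul.
Proof. by move=> s; apply: fsymP => x /=; rewrite fsym_invK. Qed.

HB.instance Definition _ := isGroup.Build (FSym T)
  fsym_mulA fsym_mul1 fsym_1mul fsym_mulV fsym_Vmul.

End FSymGroup.

Section Shuffler.
Variable H : groupType.
Implicit Types (h k : H) (s t : FSym H).

Definition fsym_act_fun h (f : H -> H) : H -> H := fun x => h * f (h^-1 * x).

Fact fsym_act_funK h s :
  cancel (fsym_act_fun h s) (fsym_act_fun h (fsym_inv s)).
Proof. by move=> x; rewrite /fsym_act_fun mulKg fsym_funK mulVKg. Qed.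

Fact fsym_act_invK h s :
  cancel (fsym_act_fun h (fsym_inv s)) (fsym_act_fun h s).
Proof. by move=> x; rewrite /fsym_act_fun mulKg fsym_invK mulVKg. Qed.

Fact fsym_act_finite h s : finite_set [set x | fsym_act_fun h s x <> x].
Proof.
apply: (@sub_finite_set _ _ ((fun y => h * y) @` [set x | s x <> x])); last first.
  by apply: finite_image; exact: fsym_finite.
move=> x /= sx.
exists (h^-1 * x); last by rewrite mulVKg.
by move=> e; apply: sx; rewrite /fsym_act_fun e mulVKg.
Qed.

Definition fsym_act h s : FSym H :=
  MkFSym (@fsym_act_funK h s) (@fsym_act_invK h s) (@fsym_act_finite h s).

Lemma fsym_actM h k s : fsym_act (h * k) s = fsym_act h (fsym_act k s).
Proof.
by apply: fsymP => x; rewrite /= /fsym_act_fun invgM !mulgA.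
Qed.

Lemma fsym_act1 s : fsym_act 1 s = s.
Proof. by apply: fsymP => x; rewrite /= /fsym_act_fun invg1 !mul1g. Qed.

Lemma fsym_act_mul h s t : fsym_act h (s * t) = fsym_act h s * fsym_act h t.
Proof. by apply: fsymP => x; rewrite /= /fsym_act_fun mulKg. Qed.

Lemma fsym_act_one h : fsym_act h 1 = 1.
Proof. by apply: fsymP => x; rewrite /= /fsym_act_fun mulVKg. Qed.

(* FSym(H) ><| H for the action [fsym_act]; [Semidirect s h] is the pair (s, h).
   A record rather than a product type, since MathComp equips the latter with
   the direct product structure. *)
Record semidirect := Semidirect { lamps : FSym H; arrow : H }.

HB.instance Definition _ := gen_eqMixin semidirect.
HB.instance Definition _ := gen_choiceMixin semidirect.

Definition sd_one := Semidirect 1 1.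
Definition sd_mul (x y : semidirect) :=
  Semidirect (lamps x * fsym_act (arrow x) (lamps y)) (arrow x * arrow y).
Definition sd_inv (x : semidirect) :=
  Semidirect (fsym_act (arrow x)^-1 (lamps x)^-1) (arrow x)^-1.

Fact sd_mulA : associative sd_mul.
Proof.
by move=> x y z; rewrite /sd_mul /= fsym_act_mul fsym_actM !mulgA.
Qed.
Fact sd_mul1 : left_id sd_one sd_mul.
Proof. by case=> s h; rewrite /sd_mul /= fsym_act1 !mul1g. Qed.
Fact sd_1mul : right_id sd_one sd_mul.
Proof. by case=> s h; rewrite /sd_mul /= fsym_act_one !mulg1. Qed.
Fact sd_mulV : left_inverse sd_one sd_inv sd_mul.
Proof.
by case=> s h; rewrite /sd_mul /= -fsym_act_mul !mulVg fsym_act_one.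
Qed.
Fact sd_Vmul : right_inverse sd_one sd_inv sd_mul.
Proof.
by case=> s h; rewrite /sd_mul /= -fsym_actM !mulgV fsym_act1 mulgV.
Qed.

HB.instance Definition _ := isGroup.Build semidirect
  sd_mulA sd_mul1 sd_1mul sd_mulV sd_Vmul.

End Shuffler.

Definition Shuffler (H : groupType) : groupType := semidirect H.

Section WordMetric.
Variable G : groupType.
Implicit Types (S w : seq G) (g : G).

(* Letters are generators or inverses of generators. *)
Definition is_word S w := all (fun s => (s \in S) || (s^-1 \in S)) w.

Definition spells S g n :=
  exists w, [/\ is_word S w, size w = n & \prod_(s <- w) s = g].

Record genset := GenSet {
  gens :> seq G;
  gens_spell : forall g, exists n, spells gens g n
}.

Fact word_length_subproof (S : genset) g : exists n, `[< spells S g n >].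
Proof. by have [n Sgn] := gens_spell S g; exists n; apply/asboolP. Qed.

Definition word_length (S : genset) g := ex_minn (word_length_subproof S g).

Definition word_dist (R : realType) (S : genset) (x y : G) : R :=
  ((word_length S (x^-1 * y))%:R)%R.

Definition word_ball (S : genset) (r : nat) : set G :=
  [set g | (word_length S g <= r)%N].

Definition finitely_generated := inhabited genset.

(* One generating set suffices: the two-sided bound for one word metric implies
   it for all of them. *)
Definition growth_degree (R : realType) (a : nat) :=
  exists S : genset, exists2 C : R, (0 < C)%R &
    forall r : nat, (0 < r)%N -> exists k : nat,
      [/\ (word_ball S r #= `I_k)%card, (C^-1 * r%:R ^+ a <= k%:R)%R
        & (k%:R <= C * r%:R ^+ a)%R].

Definition virtually_abelian :=
  exists K : {pred G},
    [/\ group_closed K, {in K &, forall x y, commute x y}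
      & finite_set (range (fun g : G => [set h : G | g^-1 * h \in K]))].

End WordMetric.

Section Maps.
Local Open Scope ring_scope.
Variables (R : realType) (X Y : Type).
Variables (dX : X -> X -> R) (dY : Y -> Y -> R).
Implicit Types f : X -> Y.

Definition quasi_isometry f :=
  exists C K : R,
    [/\ 1 <= C, 0 <= K,
        forall x x', C^-1 * dX x x' - K <= dY (f x) (f x')
                  /\ dY (f x) (f x') <= C * dX x x' + K
      & forall y, exists x, dY y (f x) <= K].

Definition quasi_isometric := exists f, quasi_isometry f.

Definition biLipschitz_equivalent :=
  exists f, quasi_isometry f /\ bijective f.

Definition regular_map f :=
  (exists2 C : R, 0 < C & forall x x', dY (f x) (f x') <= C * dX x x')
  /\ (exists2 m : nat, (1 <= m)%N & forall y, (f @^-1` [set y] #<= `I_m)%card).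

End Maps.

Section Spelling.
Variables (G : groupType) (S : seq G).

Definition spelled g := exists2 w, is_word S w & \prod_(s <- w) s = g.

Lemma spelled1 : spelled 1.
Proof. by exists [::]; rewrite ?big_nil. Qed.

Lemma spelledM g h : spelled g -> spelled h -> spelled (g * h).
Proof.
move=> [v Sv <-] [w Sw <-]; exists (v ++ w); last by rewrite big_cat.
by rewrite /is_word all_cat; apply/andP.
Qed.

Lemma spelled_gen s : s \in S -> spelled s.
Proof. by move=> Ss; exists [:: s]; rewrite ?big_seq1 //= Ss. Qed.

Lemma spelledV g : spelled g -> spelled g^-1.
Proof.
move=> [w Sw <-]; exists (rev ([seq s^-1 | s <- w])).
  rewrite /is_word all_rev all_map; apply: sub_all Sw => s /=.
  by rewrite invgK orbC.
by rewrite -map_rev big_map prodgV revK.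
Qed.

Lemma spelledP : (forall g, spelled g) -> finitely_generated G.
Proof.
by move=> SG; split; exists S => g; have [w Sw <-] := SG g; exists (size w), w.
Qed.

End Spelling.

Section Transposition.
Variable T : eqType.

Definition swap (x y : T) : T -> T :=
  fun z => if z == x then y else if z == y then x else z.

Lemma swapL x y : swap x y x = y.
Proof. by rewrite /swap eqxx. Qed.

Lemma swapR x y : swap x y y = x.
Proof. by rewrite /swap eqxx; case: eqVneq. Qed.

Lemma swapD x y z : z != x -> z != y -> swap x y z = z.
Proof. by rewrite /swap => /negPf-> /negPf->. Qed.

Fact swapK x y : involutive (swap x y).
Proof.
move=> z; rewrite /swap; have [->|zx] := eqVneq z x.
  by rewrite eqxx; case: eqVneq.
by have [->|zy] := eqVneq z y; rewrite ?eqxx // (negPf zx) (negPf zy).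
Qed.

Fact swap_finite x y : finite_set [set z | swap x y z <> z].
Proof.
apply: (@sub_finite_set _ _ [set` [:: x; y]]); last exact: finite_seq.
move=> z /=; rewrite /swap !inE.
by case: (eqVneq z x) => //= _; case: (eqVneq z y).
Qed.

Definition fsym_swap x y : FSym T :=
  MkFSym (swapK x y) (swapK x y) (swap_finite x y).

Lemma fsym_swapC x y : fsym_swap x y = fsym_swap y x.
Proof.
apply: fsymP => z /=; rewrite /swap.
by case: (eqVneq z x) => [->|_]; case: eqVneq.
Qed.

Lemma fsym_swapxx x : fsym_swap x x = 1.
Proof. by apply: fsymP => z /=; rewrite /swap; case: eqVneq. Qed.

Lemma fsym_swap_conj x y z : x != z -> y != z ->
  fsym_swap x z = fsym_swap x y * fsym_swap y z * fsym_swap x y.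
Proof.
move=> xz yz; apply: fsymP => u /=.
have [zx zy] : z != x /\ z != y by rewrite ![z == _]eq_sym.
have [->|ux] := eqVneq u x; first by rewrite !swapL swapD.
have [uy|uy] := eqVneq u y.
  by rewrite -uy in yz *; rewrite swapR (swapD ux yz) (swapD _ xz) ?swapL // eq_sym.
have [->|uz] := eqVneq u z; last by rewrite !swapD.
by rewrite [swap x y z]swapD // !swapR.
Qed.

End Transposition.

Section ShufflerFG.
Variables (H : groupType) (S : genset H).

Let arr h : Shuffler H := Semidirect 1 h.
Let lmp s : Shuffler H := Semidirect s 1.
Let T : seq (Shuffler H) :=
  map arr S ++ map (fun s => lmp (fsym_swap 1 s)) S.

Let arrM h k : arr (h * k) = arr h * arr k.
Proof. by congr Semidirect; rewrite /= fsym_act_one mulg1. Qed.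

Let arrV h : arr h^-1 = (arr h)^-1.
Proof. by congr Semidirect; rewrite /= invg1 fsym_act_one. Qed.

Let lmpM s t : lmp (s * t) = lmp s * lmp t.
Proof. by congr Semidirect; rewrite /= ?fsym_act1 ?mulg1. Qed.

Let lmp_act h s : lmp (fsym_act h s) = arr h * lmp s * arr h^-1.
Proof.
by congr Semidirect; rewrite /= ?mul1g ?mulg1 ?mulgV // fsym_act_one mulg1.
Qed.

Let mem_arr s : s \in (S : seq H) -> spelled T (arr s).
Proof. by move=> Ss; apply: spelled_gen; rewrite mem_cat map_f. Qed.

Let mem_lmp s : s \in (S : seq H) -> spelled T (lmp (fsym_swap 1 s)).
Proof.
move=> Ss; apply: spelled_gen; rewrite mem_cat; apply/orP; right.
exact: (map_f (fun s => lmp (fsym_swap 1 s))).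
Qed.

Let spelled_arr h : spelled T (arr h).
Proof.
have [n [w [Sw _ <-]]] := gens_spell S h.
elim: w Sw => [|s w IHw] /=; first by rewrite big_nil => _; exact: spelled1.
move=> /andP[/orP[Ss|Ss] /IHw Tw]; rewrite big_cons arrM; apply: spelledM => //.
  exact: mem_arr.
by rewrite -[s]invgK arrV; apply: spelledV; exact: mem_arr.
Qed.

Let fsym_act_swap (h x y : H) :
  fsym_act h (fsym_swap x y) = fsym_swap (h * x) (h * y).
Proof.
apply: fsymP => z /=; rewrite /fsym_act_fun /swap.
rewrite -(inj_eq (mulgI h) _ x) -(inj_eq (mulgI h) _ y) mulVKg.
by case: eqP => // _; case: eqP => // _; rewrite mulVKg.
Qed.

Let spelled_edge (x s : H) : (s \in (S : seq H)) || (s^-1 \in (S : seq H)) ->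
  spelled T (lmp (fsym_swap x (x * s))).
Proof.
have edge y t : t \in (S : seq H) -> spelled T (lmp (fsym_swap y (y * t))).
  move=> St; rewrite -{1}[y]mulg1 -fsym_act_swap lmp_act.
  apply: spelledM; last exact: spelled_arr.
  by apply: spelledM; [exact: spelled_arr|exact: mem_lmp].
case/orP => Ss; first exact: edge.
by rewrite fsym_swapC -{2}(mulgK s x); apply: edge.
Qed.

Let spelled_swap (x y : H) : spelled T (lmp (fsym_swap x y)).
Proof.
rewrite -(mulVKg x y).
have [n [w [Sw _ <-]]] := gens_spell S (x^-1 * y).
elim: w x Sw {y} => [|s w IHw] x /=.
  by rewrite big_nil mulg1 fsym_swapxx => _; exact: spelled1.
move=> /andP[Ss Sw]; rewrite big_cons mulgA.
have Te := spelled_edge x Ss; have {}IHw := IHw (x * s) Sw.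
move: (x * s * _) IHw => z IHw.
have [->|xz] := eqVneq x z; first by rewrite fsym_swapxx; exact: spelled1.
have [<-//|yz] := eqVneq (x * s) z.
by rewrite (fsym_swap_conj xz yz) !lmpM; do !apply: spelledM.
Qed.

Let spelled_lmp (s : FSym H) : spelled T (lmp s).
Proof.
have /finite_seqP[l sl] := fsym_finite s.
have {sl} : forall x, s x <> x -> x \in l.
  by move=> x sx; have : [set x | s x <> x] x by []; rewrite sl.
elim: l s => [|x l IHl] s sl.
  have -> : s = 1; last exact: spelled1.
  by apply: fsymP => x; apply: contrapT => /sl; rewrite in_nil.
have -> : s = fsym_swap x (s x) * (fsym_swap x (s x) * s).
  by apply: fsymP => z /=; rewrite swapK.
rewrite lmpM; apply: spelledM; first exact: spelled_swap.
apply: IHl => z /=; rewrite /swap.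
have [->|zx] := eqVneq z x; first by rewrite eqxx; case: eqVneq.
move=> Hz; have : z \in x :: l.
  apply: sl => sz; apply: Hz; rewrite sz (negPf zx).
  case: eqVneq => // zsx; move: zx; rewrite -(inj_eq (can_inj (fsym_funK s))).
  by rewrite sz zsx eqxx.
by rewrite inE (negPf zx).
Qed.

Lemma finitely_generated_Shuffler : finitely_generated (Shuffler H).
Proof.
apply: (@spelledP _ T) => -[s h].
have -> : Semidirect s h = lmp s * arr h :> Shuffler H.
  by congr Semidirect; rewrite /= ?fsym_act1 ?mulg1 ?mul1g.
by apply: spelledM.
Qed.

End ShufflerFG.

Lemma finitely_generated_iter_Shuffler (n : nat) (H : groupType) :
  finitely_generated H -> finitely_generated (iter n Shuffler H).
Proof. by move=> fgH; elim: n => //= n [S]; exact: finitely_generated_Shuffler. Qed.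

(* Main.v *)
From HB Require Import structures.
From mathcomp Require Import all_boot all_order all_algebra finmap.
From mathcomp Require Import boolp classical_sets functions cardinality reals.
From mathcomp Require Import zify lra.
Require Import Defs.

(* The Følner function of a group (the least size of a finite U with |U g \ U| <= |U| / k
   for g in a fixed finite set) is monotone under regular maps into Y from an amenable X:
   averaging the sets f^-1(g V) over g in Y, where V is a Følner set of Y, yields Følner
   sets of X. If H has Følner function F, then F^(F+1) bounds that of Shuffler(H) above
   (take Sym(U) x U), and, following Erschler, 2^(F/8) bounds it below up to constants. Since
   groups of growth degree a have Følner function k^a, regular maps in both directions force
   n = m and a = b. Conversely, an infinite virtually abelian group of growth degree a is in
   biLipschitz bijection with Z^a, and Shuffler is functorial for such bijections. *)

Set Implicit Arguments.
Unset Strict Implicit.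
Unset Printing Implicit Defensive.

Import Order.TTheory GRing.Theory Num.Theory.

Local Open Scope nat_scope.
Local Open Scope group_scope.

(** The two bounds for lampshufflers do not match: one level turns F into F^(F+1) on one side and
    into 2^(F/8) on the other, so the towers cannot be compared factor by factor. What survives both
    recursions is a gap f >= M g log g for every M: since log (g^(g+1)) is about g log g, such a gap
    reproduces itself one exponential higher. Powers k^a and k^b with b < a have this gap, and so do
    an exponential and a polynomial. No Følner function is formed as a minimum. An upper bound is
    asserted for every finite test set, a lower bound for some test set, and constants multiply the
    argument k; the two can then be played against each other without inverting functions or
    changing generators. For the same reason Lipschitz maps give way to [coarse] maps, which mention
    no generating set. A quasi-isometry is coarse with bounded fibers, and so is a quasi-inverse of
    it, so one obstruction serves both (i) and (ii). *)

(** * Counting in finite lists *)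

Lemma count_big (T : Type) (P : pred T) (s : seq T) :
  count P s = \sum_(x <- s) P x.
Proof. by elim: s => [|x s IH] /=; rewrite ?big_nil ?big_cons ?IH. Qed.

Lemma leq_count_inj (T T' : eqType) (s : seq T) (t : seq T')
    (P : pred T) (Q : pred T') (h : T -> T') :
    uniq s -> {in [pred x in s | P x] &, injective h} ->
    (forall x, x \in s -> P x -> (h x \in t) && Q (h x)) ->
  count P s <= count Q t.
Proof.
move=> us injh hP; rewrite -!size_filter -(size_map h).
apply: uniq_leq_size.
  rewrite map_inj_in_uniq ?filter_uniq // => x y.
  by rewrite !mem_filter => /andP[Px xs] /andP[Py ys]; apply: injh; rewrite inE /= ?xs ?ys.
by move=> _ /mapP[x + ->]; rewrite !mem_filter andbC => /andP[/hP h1 /h1 /andP[-> ->]].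
Qed.

Lemma leq_size_inj (T T' : eqType) (s : seq T) (t : seq T') (h : T -> T') :
    uniq s -> {in s &, injective h} -> (forall x, x \in s -> h x \in t) ->
  size s <= size t.
Proof.
move=> us injh st; rewrite -count_predT -(count_predT t).
apply: (@leq_count_inj _ _ _ _ _ _ h) => // [x y|x /st->//].
by rewrite !inE !andbT; exact: injh.
Qed.

Lemma card_fset_count (T : choiceType) (U : {fset T}) (P : pred T) :
  #|` [fset x in U | P x]%fset| = count P U.
Proof.
rewrite -size_filter; apply/perm_size/uniq_perm.
- exact: fset_uniq.
- by rewrite filter_uniq.
by move=> x; rewrite mem_filter !inE andbC.
Qed.

Lemma ltn_sum_exists (I : eqType) (s : seq I) (F G : I -> nat) :
  \sum_(i <- s) F i < \sum_(i <- s) G i -> exists2 i, i \in s & F i < G i.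
Proof.
move=> lt; case: (boolP (has (fun i => F i < G i) s)) => [/hasP//|/hasPn hn].
move: lt; rewrite ltnNge; case/negP; rewrite big_seq [leqRHS]big_seq.
by apply: leq_sum => i /hn; rewrite -leqNgt.
Qed.

Lemma count_partition (T I : eqType) (s : seq T) (D : seq I) (f : T -> I)
    (P : pred T) :
  uniq D -> {in s, forall x, f x \in D} ->
  count P s = \sum_(i <- D) count (fun x => (f x == i) && P x) s.
Proof.
move=> uD sD; under eq_bigr do rewrite count_big.
rewrite exchange_big count_big /=; apply: eq_big_seq => x xs.
rewrite -count_big; case: (P x); last first.
  by rewrite (eq_count (a2 := pred0)) ?count_pred0 // => i; rewrite andbF.
have := count_uniq_mem (f x) uD; rewrite sD // => <-.
by apply: eq_count => i /=; rewrite andbT eq_sym.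
Qed.

(** * Følner sets and their boundaries *)

Section Folner.
Variable G : groupType.
Implicit Types (U : {fset G}) (L : seq G) (k : nat).

Definition bdry U g := count (fun x => x * g \notin U) U.

Definition folner L k U :=
  (0 < #|` U|) /\ {in L, forall g, k * bdry U g <= #|` U|}.

Lemma bdry1 U : bdry U 1 = 0.
Proof.
by rewrite /bdry; apply/eqP; rewrite eqn0Ngt -has_count; apply/hasPn => x xU; rewrite mulg1 xU.
Qed.

(** A point pushed out of [U] by [g * h] either leaves under [g], or its translate by [g] lies in
    [U] and leaves under [h]. *)
Lemma bdryM U g h : bdry U (g * h) <= bdry U g + bdry U h.
Proof.
pose Q x := (x * g \in U) && (x * (g * h) \notin U).
apply: (@leq_trans (bdry U g + count Q U)).
  rewrite /bdry !count_big -big_split /=; apply: leq_sum => x _.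
  by rewrite /Q; case: (x * g \in U) => /=; case: (_ \notin U).
rewrite leq_add2l; apply: (@leq_count_inj _ _ _ _ _ _ (fun x => x * g)).
- exact: fset_uniq.
- by move=> x y _ _ /mulIg.
by move=> x xU /andP[-> ]; rewrite mulgA => ->.
Qed.

Lemma bdry_word U L w k b : {in L, forall g, k * bdry U g <= b} ->
  {in w, forall g, g \in L} -> k * bdry U (\prod_(g <- w) g) <= size w * b.
Proof.
move=> Lb; elim: w => [|g w IH] wL /=; first by rewrite big_nil bdry1 muln0.
rewrite big_cons mulSn; apply: leq_trans (leq_mul (leqnn k) (bdryM _ _ _)) _.
rewrite mulnDr; apply: leq_add; first by apply/Lb/wL; rewrite mem_head.
by apply: IH => x xw; apply: wL; rewrite inE xw orbT.
Qed.

Definition folner_upper (psi : nat -> nat) :=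
  forall L, exists2 C, 0 < C &
    forall k, 0 < k -> exists2 U, folner L k U & #|` U| <= psi (C * k)%N.

Definition folner_lower (phi : nat -> nat) :=
  exists L, exists2 C, 0 < C &
    forall k U, 0 < k -> folner L (C * k)%N U -> phi k <= #|` U|.

End Folner.

(** * Følner functions of lampshufflers: lower bound *)

Section Pruning.
Variables (X Y : choiceType) (U : {fset X}) (p : X -> Y) (tau : X -> X).
Hypothesis tauK : involutive tau.
Implicit Types (W : {fset Y}) (y : Y).

(** In the application [p] is [lamps] and [tau] is right multiplication by a transposition lamp. A
    point is live when its partner also lies in [U] over [W]. *)
Let weight W := count (fun x => p x \in W) U.
Let live W := count (fun x => [&& p x \in W, tau x \in U & p (tau x) \in W]) U.
Let wt y := count (fun x => p x == y) U.
Let lv W y := count (fun x => [&& p x == y, tau x \in U & p (tau x) \in W]) U.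

Let weightD1 W y : y \in W -> weight W = weight (W `\ y)%fset + wt y.
Proof.
move=> yW; rewrite /weight /wt !count_big -big_split /=; apply: eq_bigr => x _.
by rewrite !inE; case: eqP => [->|_]; rewrite ?yW ?addn0.
Qed.

Let liveD1 W y : y \in W -> live W <= live (W `\ y)%fset + (lv W y).*2.
Proof.
move=> yW; rewrite -addnn addnA.
(* [tau] carries the points whose partner lies over [y] injectively to live points over [y]. *)
have le2 : count (fun x => [&& p x \in W, tau x \in U & p (tau x) == y]) U <= lv W y.
  apply: (@leq_count_inj _ _ _ _ _ _ tau); rewrite ?fset_uniq //.
    by move=> u v _ _; exact: can_inj tauK _ _.
  by move=> x xU /and3P[pW tU /eqP pt]; rewrite tauK tU xU pW pt eqxx.
apply: leq_trans (leq_add (leqnn _) le2).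
rewrite /live /lv !count_big -!big_split /=; apply: leq_sum => x _.
rewrite !inE; case: (p x \in W) (p x =P y) => [] [_|//] //=;
  by case: (tau x \in U) => //=; case: eqP; case: (p (tau x) \in W) => //=; rewrite ?addn0 ?andbF ?andbT.
Qed.

(* Deleting a y with too few live points kills at most twice as many live points (its
   own and their partners), so 2 live - weight never decreases along the way. *)
Lemma prune_fibers W : weight W < (live W).*2 ->
  exists W', [/\ (W' `<=` W)%fset, W' != fset0 &
    {in W', forall y, wt y <= 4 * lv W' y}].
Proof.
have [n] := ubnP #|` W|; elim: n => // n IH in W *; rewrite ltnS => Wn lt.
have [/allP ok|/allPn[y yW /=]] := boolP (all (fun y => wt y <= 4 * lv W y) W).
  exists W; split=> //; apply: contraTneq lt => ->.
  rewrite /weight /live; rewrite -leqNgt.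
  by rewrite (eq_count (a2 := pred0)) ?count_pred0 // => x /=; rewrite in_fset0.
rewrite -ltnNge => bad.
case: (IH (W `\ y)%fset).
- by move: Wn; rewrite (cardfsD1 y) yW; lia.
- by move: (weightD1 yW) (liveD1 yW); lia.
move=> W' [sub W0 ok]; exists W'; split=> //.
exact: fsubset_trans sub (fsubD1set _ _).
Qed.

End Pruning.

Section DenseSwaps.
Variable H : groupType.

Lemma fsym_inj (s : FSym H) : injective s.
Proof. exact: can_inj (fsym_funK s). Qed.

(* Splitting W by the value at a point p costs each member at most the two swaps
   moving p. *)
Lemma card_dense_swaps (s : H) (W : {fset FSym H}) D : s != 1 -> W != fset0 ->
  {in W, forall w, exists2 E : {fset H}, D.*2 <= #|` E| &
     {in E, forall h, w * fsym_swap h (h * s) \in W}} ->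
  2 ^ D <= #|` W|.
Proof.
move=> s1; elim: D W => [|D IH] W W0 dense; first by rewrite cardfs_gt0.
have [w wW] := fset0Pn _ W0.
have [E] := dense w wW; rewrite doubleS => cE EW.
have /fset0Pn[p pE] : E != fset0 by rewrite -cardfs_gt0; apply: leq_trans cE.
have wW' := EW p pE.
set w' : FSym H := w * _ in wW'.
have neq : w' p != w p.
  rewrite /w' /= swapL (inj_eq (@fsym_inj w)).
  by apply: contra_neq s1 => e; apply: (mulgI p); rewrite e mulg1.
(* The swap at [h] moves [p] only for [h = p] and [h = p * s^-1]. Every other swap keeps the value
   at [p], so both halves of [W] inherit density with [D]. Both are nonempty since [w] and [w']
   differ at [p]. *)
have half (W1 : {fset FSym H}) (v : H) (b : bool) :
    (forall u, (u \in W1) = (u \in W) && ((u p == v) == b)) ->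
    W1 != fset0 -> 2 ^ D <= #|` W1|.
  move=> W1P W10; apply: IH => // u; rewrite W1P => /andP[uW uv].
  have [F cF FW] := dense u uW.
  exists ((F `\ p) `\ (p * s^-1))%fset.
    move: cF; rewrite (cardfsD1 p F) (cardfsD1 (p * s^-1) (F `\ p)%fset) doubleS.
    case: (p \in F); case: (_ \in (F `\ p)%fset);
      rewrite ?add1n ?add0n ?ltnS // => cF; by [exact: ltnW | do 2!apply: ltnW].
  move=> h; rewrite !inE => /and3P[h1 h2 hF].
  rewrite W1P FW //= swapD //; first by rewrite eq_sym.
  by apply: contra_neq h1 => ->; rewrite mulgK.
pose W1 b := [fset u in W | (u p == w p) == b]%fset.
have memW1 b u : (u \in W1 b) = (u \in W) && ((u p == w p) == b) by rewrite !inE.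
have le1 : 2 ^ D <= #|` W1 true|.
  apply: (half _ (w p) true) => //; apply/fset0Pn; exists w.
  by rewrite memW1 wW eqxx.
have le2 : 2 ^ D <= #|` W1 false|.
  apply: (half _ (w p) false) => //; apply/fset0Pn; exists w'.
  by rewrite memW1 wW' (negPf neq).
rewrite expnS mul2n -addnn; apply: leq_trans (leq_add le1 le2) _.
pose P (u : FSym H) := (u p == w p) == true; rewrite /W1 !card_fset_count.
rewrite -(count_predC P W) leq_add2l; apply: sub_count => u.
by rewrite /= /P; case: (u p == w p).
Qed.

End DenseSwaps.

Section ShufflerLower.
Variable H : groupType.
Implicit Types (U : {fset Shuffler H}) (w : FSym H) (h : H).

Definition arr h : Shuffler H := Semidirect 1 h.
Definition lmp w : Shuffler H := Semidirect w 1.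

Lemma mul_arr w h k : Semidirect w h * arr k = Semidirect w (h * k) :> Shuffler H.
Proof. by congr Semidirect; rewrite /= fsym_act_one mulg1. Qed.

Lemma mul_lmp w u h :
  Semidirect w h * lmp u = Semidirect (w * fsym_act h u) h :> Shuffler H.
Proof. by congr Semidirect; rewrite /= mulg1. Qed.

Lemma fsym_act_swap h x y :
  fsym_act h (fsym_swap x y) = fsym_swap (h * x) (h * y).
Proof.
apply: fsymP => z /=; rewrite /fsym_act_fun /swap.
rewrite -(inj_eq (mulgI h) _ x) -(inj_eq (mulgI h) _ y) mulVKg.
by case: eqP => // _; case: eqP => // _; rewrite mulVKg.
Qed.

Lemma fsym_swap2 (x y : H) : fsym_swap x y * fsym_swap x y = 1.
Proof. by apply: fsymP => z; exact: swapK. Qed.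

Let mkS : H -> FSym H -> Shuffler H := fun h w => Semidirect w h.

Definition fiber U w : {fset H} := [fset arrow x | x in [fset x in U | lamps x == w]]%fset.

Lemma mem_fiber U w h : (h \in fiber U w) = (mkS h w \in U).
Proof.
apply/imfsetP/idP => [[[w' h'] /=]|hU].
  by rewrite !inE /= => /andP[xU /eqP <-] ->.
by exists (mkS h w) => //=; rewrite !inE hU eqxx.
Qed.

Lemma count_fiber U w (P : pred (Shuffler H)) :
  count (fun x => (lamps x == w) && P x) U = count (fun h => P (mkS h w)) (fiber U w).
Proof.
apply/eqP; rewrite eqn_leq; apply/andP; split.
  apply: (@leq_count_inj _ _ _ _ _ _ (@arrow H)).
  - exact: fset_uniq.
  - move=> [u h] [u' h']; rewrite !inE /= => /and3P[_ /eqP -> _] /and3P[_ /eqP -> _].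
    by move=> ->.
  - by move=> [u h] xU /= /andP[/eqP uw Px]; rewrite mem_fiber /mkS -uw xU.
apply: (@leq_count_inj _ _ _ _ _ _ (fun h => mkS h w)).
- exact: fset_uniq.
- by move=> h k _ _ [].
- by move=> h; rewrite mem_fiber => -> /= ->; rewrite eqxx.
Qed.

Lemma card_fiber U w : #|` fiber U w| = count (fun x => lamps x == w) U.
Proof.
rewrite -(eq_count (a1 := fun x => (lamps x == w) && predT x)) => [|x /=].
  by rewrite count_fiber count_predT.
by rewrite andbT.
Qed.

(** Slice [U] by lamp configuration. Most of its mass lies in slices that are Følner sets of [H],
    hence have at least [phi k] points. Each point [h] of a slice offers the swap of [h] and
    [h * s], which most often leads to another good slice. The configurations are thus closed under
    many swaps, which forces exponentially many of them. *)
Lemma folner_lower_Shuffler (s : H) (phi : nat -> nat) : s != 1 ->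
  folner_lower H phi -> folner_lower (Shuffler H) (fun k => 2 ^ (phi k %/ 8))%N.
Proof.
move=> s1 [L [C C0 low]].
pose t := lmp (fsym_swap 1 s).
(* The factor [C * size L + 1] pays for the union over [L] and for the constant of [H]; 16 leaves
   room for the three losses counted in [Ulive]. *)
exists (t :: map arr L), (16 * (C * size L + 1))%N => [|k U k0 [U0 UL]]; first by lia.
pose tau (x : Shuffler H) := x * t.
have tt : t * t = 1.
  by rewrite /t mul_lmp fsym_act1 fsym_swap2.
have tauK : involutive tau by move=> x; rewrite /tau -mulgA tt mulg1.
have tauE w h : tau (mkS h w) = mkS h (w * fsym_swap h (h * s)).
  by rewrite /tau mul_lmp fsym_act_swap mulg1.
pose proj := [fset lamps x | x in U]%fset.
have projP x : x \in U -> lamps x \in proj by move=> xU; apply: in_imfset.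
pose good w := all (fun l => (C * k) * bdry (fiber U w) l <= #|` fiber U w|)%N L.
pose V := [fset w in proj | good w]%fset.
pose bad := count (fun x => lamps x \notin V) U.
(* A bad fiber has boundary above its size / (C k), so the bad fibers together weigh at
   most C k times the boundary of U in the directions of L. *)
have bad16 : (16 * bad <= #|` U|)%N.
  have Ubd l : l \in L -> (16 * (C * size L + 1) * k * bdry U (arr l) <= #|` U|)%N.
    by move=> lL; apply: UL; rewrite inE map_f ?orbT.
  have sumL : (16 * (C * size L + 1) * k * \sum_(l <- L) bdry U (arr l) <= size L * #|` U|)%N.
    rewrite -[X in (_ <= X * _)%N]sum1_size big_distrr big_distrl /= big_seq [leqRHS]big_seq.
    by apply: leq_sum => l /Ubd; rewrite mul1n.
  have badL : (bad <= C * k * \sum_(l <- L) bdry U (arr l))%N.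
    rewrite /bad (count_partition _ (fset_uniq proj) projP).
    under [X in (_ <= _ * X)%N]eq_bigr => l _ do
      rewrite /bdry (count_partition _ (fset_uniq proj) projP).
    rewrite exchange_big big_distrr /= big_seq [leqRHS]big_seq.
    apply: leq_sum => w wp.
    have [wV|wV] := boolP (w \in V).
      rewrite (eq_count (a2 := pred0)) ?count_pred0 // => x /=.
      by case: eqP => // ->; rewrite wV.
    have : ~~ good w by move: wV; rewrite !inE /= wp.
    move=> /allPn[l lL]; rewrite -ltnNge => /ltnW bl.
    apply: (@leq_trans #|` fiber U w|).
      by rewrite card_fiber; apply: sub_count => x /andP[].
    apply: leq_trans bl _; rewrite leq_mul2l; apply/orP; right.
    rewrite (big_rem l lL) /= -[leqLHS]addn0; apply: leq_add => //.
    rewrite count_fiber /bdry; apply: sub_count => h /=.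
    by rewrite mul_arr mem_fiber.
  rewrite -(@leq_pmul2l (C * size L + 1)%N) ?addn1 //.
  apply: (@leq_trans (C * (size L * #|` U|))%N); last by lia.
  apply: leq_trans (leq_mul (leqnn C) sumL).
  rewrite mulnCA addn1; apply: leq_trans (leq_mul (leqnn _) (leq_mul (leqnn _) badL)) _.
  by lia.
have t16 : (16 * bdry U t <= #|` U|)%N.
  by apply: leq_trans (UL t (mem_head _ _)); rewrite leq_mul2r; lia.
have le_part : (count (fun x => (tau x \in U) && (lamps (tau x) \notin V)) U <= bad)%N.
  apply: (@leq_count_inj _ _ _ _ _ _ tau).
  - exact: fset_uniq.
  - by move=> x y _ _ /(can_inj tauK).
  - by move=> x xU.
pose live := count (fun x => [&& lamps x \in V, tau x \in U & lamps (tau x) \in V]) U.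
have Ulive : (#|` U| <= live + bad + bdry U t + bad)%N.
  apply: leq_trans (leq_add (leqnn _) le_part).
  rewrite -(count_predT U) /live /bad /bdry !count_big -!big_split /=.
  apply: leq_sum => x _; rewrite -/(tau x).
  by case: (lamps x \in V); case: (tau x \in U); case: (lamps (tau x) \in V).
(* At most 3/16 of [U] is lost, so more than half of it is live, as pruning requires. *)
have : (count (fun x => lamps x \in V) U < live.*2)%N.
  apply: leq_ltn_trans (count_size _ _) _; rewrite -/(#|` U|).
  have arith u a b c : (0 < u -> u <= c + a + b + a -> 16 * b <= u -> 16 * a <= u ->
    u < c.*2)%N by lia.
  exact: arith U0 Ulive t16 bad16.
move=> /(prune_fibers tauK)[W [WV W0 Wlv]].
have WU : (#|` W| <= #|` U|)%N.
  have le1 : (#|` proj| <= #|` U|)%N by exact: leq_imfset_card.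
  apply: leq_trans le1; apply: fsubset_leq_card.
  by apply/fsubsetP => w /(fsubsetP WV); rewrite !inE => /andP[].
apply: leq_trans WU; apply: (card_dense_swaps s1 W0) => w wW.
have wV := fsubsetP WV w wW.
pose E := [fset h in fiber U w | (tau (mkS h w) \in U) && (lamps (tau (mkS h w)) \in W)]%fset.
exists E; last first.
  move=> h; have -> : w * fsym_swap h (h * s) = lamps (tau (mkS h w)) by rewrite tauE.
  by rewrite [in X in X -> _]inE /= => /andP[_ /andP[_]].
(* After pruning, at least a quarter of a slice of size at least [phi k] is live, and
   [card_dense_swaps] spends two swaps per doubling: hence the division by 8. *)
have : (phi k <= #|` fiber U w|)%N.
  apply: low => //; move: wV; rewrite !inE /= => /andP[/imfsetP[x /= xU ->] /allP gw].
  split=> //; rewrite cardfs_gt0; apply/fset0Pn; exists (arrow x).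
  by rewrite mem_fiber /mkS; case: (x) xU.
have := Wlv w wW; rewrite -card_fiber count_fiber -(card_fset_count (fiber U w)) -/E.
have arith u e f : (u <= 4 * e -> f <= u -> (f %/ 8).*2 <= e)%N by lia.
exact: arith.
Qed.

End ShufflerLower.

(** * Følner functions of lampshufflers: upper bound *)

Section ShufflerUpper.
Variable H : groupType.

(** The permutations supported in [F] are recovered from their restrictions, which are maps from [F]
    to itself; the crude count of all such maps is enough. *)
Lemma fsym_onP (F : {fset H}) : exists2 W : {fset FSym H},
  (forall w, w \in W <-> (forall x, x \notin F -> w x = x)) &
  0 < #|` W| <= (#|` F| ^ #|` F|)%N.
Proof.
pose on (w : FSym H) := forall x, x \notin F -> w x = x.
have on1 : on 1 by [].
have on_mem w x : on w -> x \in F -> w x \in F.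
  move=> wF xF; apply/negPn/negP => wxF; move: (wxF).
  by have /(@fsym_inj _ w) -> := wF _ wxF; rewrite xF.
pose code (w : FSym H) : {ffun F -> F} := [ffun x => insubd x (w (val x))].
have code_inj w u : on w -> on u -> code w = code u -> w = u.
  move=> wF uF e; apply: fsymP => x; have [xF|xF] := boolP (x \in F); last first.
    by rewrite wF // uF.
  have := congr1 (fun f : {ffun F -> F} => val (f [` xF]%fset)) e.
  by rewrite !ffunE !val_insubd /= !on_mem.
(* The default 1 is itself supported in [F], so decoding a map that is no code still lands in the
   intended set. *)
pose dec (g : {ffun F -> F}) := xget (1 : FSym H) [set w | on w /\ code w = g]%classic.
have dec_on g : on (dec g) by rewrite /dec; case: xgetP => // w _ [].
have codeK w : on w -> dec (code w) = w.
  move=> wF; rewrite /dec; case: xgetP => [u _ [uF]|/(_ w)]; last by case.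
  exact: code_inj.
exists [fset dec g | g in {: {ffun F -> F}}]%fset.
  move=> w; split=> [/imfsetP[g _ ->]|/codeK <-]; first exact: dec_on.
  exact: in_imfset.
apply/andP; split.
  rewrite cardfs_gt0; apply/fset0Pn; exists (dec (code 1)); exact: in_imfset.
apply: leq_trans (leq_imfset_card _ _ _) _.
by rewrite /= -cardE card_ffun -cardfE.
Qed.

Definition fsupp (w : FSym H) : seq H := fset_set [set x | w x <> x]%classic.

Lemma fsuppP (w : FSym H) x : x \notin fsupp w -> w x = x.
Proof.
rewrite /fsupp in_fset_set; last exact: fsym_finite.
by move=> /negP wx; apply: contrapT => wxx; apply: wx; rewrite inE.
Qed.

(** With [U] made of the pairs of a permutation supported in [F] and a point of [F], right
    multiplication of (w, h) by [x] stays in [U] as soon as h l lies in [F] for all l in [moves x]: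
    the arrow must stay in [F], and so must the support of the lamps translated by h. A Følner set
    [F] for all these elements therefore suffices. *)
Lemma folner_upper_Shuffler (psi : nat -> nat) :
  folner_upper H psi -> folner_upper (Shuffler H) (fun k => psi k ^ (psi k).+1)%N.
Proof.
move=> up L.
pose moves (x : Shuffler H) : seq H := arrow x :: fsupp (lamps x).
pose L' := flatten (map moves L).
(* The number of all moves, which absorbs the union bound over the moves of any one [x]. *)
pose c := (\sum_(x <- L) size (moves x)).+1.
have [C C0 {}up] := up L'.
exists (C * c)%N => [|k k0]; first by rewrite muln_gt0 C0.
have [F [F0 FL] Fpsi] : exists2 F, folner L' (c * k)%N F & #|` F| <= psi (C * (c * k))%N.
  by apply: up; rewrite muln_gt0 k0.
have [W WP /andP[W0 Wle]] := fsym_onP F.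
pose s := [seq (Semidirect w h : Shuffler H) | w <- W, h <- F].
pose U := [fset x in s]%fset.
have memU w h : (Semidirect w h \in U) = (w \in W) && (h \in F).
  rewrite !inE; apply/allpairsP/andP => [[[w' h'] /= [? ? [-> ->]]]|[wW hF]]//.
  by exists (w, h).
have cardU : #|` U| = (#|` W| * #|` F|)%N.
  rewrite card_fseq undup_id ?size_allpairs // allpairs_uniq ?fset_uniq //.
  by move=> [? ?] [? ?] _ _ /= [-> ->].
exists U; last first.
  rewrite cardU -mulnA; move: (psi _) Fpsi => p Fp.
  apply: (@leq_trans (#|` F| ^ #|` F| * #|` F|)%N); first by rewrite leq_mul2r Wle orbT.
  rewrite -expnSr; apply: (@leq_trans (p ^ #|` F|.+1)%N); first by rewrite leq_exp2r.
  by apply: leq_pexp2l; rewrite ?ltnS //; apply: leq_trans Fp.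
split=> [|x xL]; first by rewrite cardU muln_gt0 W0.
have bdx : (bdry U x <= #|` W| * \sum_(l <- moves x) bdry F l)%N.
  have UW : {in U, forall y : Shuffler H, lamps y \in W}.
    by move=> [w h]; rewrite memU => /andP[].
  rewrite /bdry (count_partition _ (fset_uniq W) UW) -sum1_size big_distrl /=.
  rewrite big_seq [leqRHS]big_seq; apply: leq_sum => w wW; rewrite mul1n.
  apply: (@leq_trans (count (fun h => has (fun l => h * l \notin F) (moves x)) F)).
    apply: (@leq_count_inj _ _ _ _ _ _ (@arrow H)).
    - exact: fset_uniq.
    - move=> [u h] [u' h']; rewrite !inE /= => /and3P[_ /eqP -> _] /and3P[_ /eqP -> _].
      by move=> ->.
    - move=> [u h]; rewrite memU => /andP[_ hF] /andP[/eqP /= -> +]; rewrite hF /=.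
      apply: contraR; rewrite negb_or negbK => /andP[hx /hasPn hsupp].
      rewrite memU hx andbT; apply/WP => y yF.
      change (w (fsym_act h (lamps x) y) = y).
      suff -> : fsym_act h (lamps x) y = y by exact: (WP w).1 wW y yF.
      rewrite /= /fsym_act_fun fsuppP ?mulVKg //.
      by apply: contra yF => /hsupp; rewrite negbK mulVKg.
  elim: (moves x) => [|l m IH] /=; first by rewrite count_pred0.
  rewrite big_cons; apply: leq_trans (leq_add (leqnn _) IH).
  rewrite /bdry !count_big -big_split /=; apply: leq_sum => h _.
  by case: (_ \notin F) => //=; rewrite leq_addr.
have sum_le : (c * k * \sum_(l <- moves x) bdry F l <= c * #|` F|)%N.
  apply: (@leq_trans (size (moves x) * #|` F|)%N); last first.
    by rewrite leq_mul2r /c (big_rem x xL) /= -addnS leq_addr orbT.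
  rewrite -sum1_size big_distrr big_distrl /= big_seq [leqRHS]big_seq.
  apply: leq_sum => l lx; rewrite mul1n; apply: FL.
  by apply/flattenP; exists (moves x) => //; exact: map_f.
rewrite cardU; apply: leq_trans (leq_mul (leqnn k) bdx) _.
rewrite mulnCA leq_mul2l; apply/orP; right.
by rewrite -(@leq_pmul2l c) // mulnA.
Qed.

End ShufflerUpper.

(** * Monotonicity of Følner functions *)

Section Coarse.
Variables (X Y : groupType) (f : X -> Y).

(* Between finitely generated groups: f is Lipschitz for the word metrics. *)
Definition coarse := forall s, finite_set (range (fun x => (f x)^-1 * f (x * s))).

Definition bounded_fibers := exists m, forall y (l : seq X),
  uniq l -> {in l, forall x, f x = y} -> size l <= m.

Lemma folner_upper_coarse (chi psi : nat -> nat) : coarse -> bounded_fibers ->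
  folner_upper X chi -> folner_upper Y psi -> exists m, folner_upper X (fun k => m * psi k)%N.
Proof.
move=> cf [m fm] upX upY; exists m => L.
pose L' := flatten
  [seq (fset_set (range (fun x => (f x)^-1 * f (x * s))) : seq Y) | s <- L].
have L'P s x : s \in L -> (f x)^-1 * f (x * s) \in L'.
  move=> sL; apply/flattenP; eexists; first exact: (map_f _ sL).
  by rewrite /= in_fset_set ?inE //=; exists x.
have [C C0 {}upY] := upY L'.
(* Each letter has two boundary contributions, from [O] and from [F]; the successor makes the
   averaged inequality strict, so the chosen piece is nonempty. *)
pose c := (2 * size L).+1.
exists (C * c)%N => [|k k0]; first by rewrite muln_gt0 C0.
have K0 : 0 < c * k by rewrite muln_gt0 k0.
have [F [F0 FL] Fpsi] := upY _ K0.
have [C' _ {}upX] := upX L.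
have [O [O0 OL] _] := upX _ K0.
(* All g for which [V g] can be nonempty. *)
pose Z := undup [seq f x * h^-1 | x <- O, h <- F].
pose V g := [fset x in O | g^-1 * f x \in F]%fset.
have cardV g : #|` V g| = count (fun x => g^-1 * f x \in F) O.
  by rewrite card_fset_count.
have sumV : (#|` O| * #|` F| <= \sum_(g <- Z) #|` V g|)%N.
  under eq_bigr do rewrite cardV count_big.
  rewrite exchange_big -sum1_size big_distrl /= big_seq [leqRHS]big_seq.
  apply: leq_sum => x xO; rewrite mul1n -count_big -[leqLHS]count_predT.
  apply: (@leq_count_inj _ _ _ _ _ _ (fun h => f x * h^-1)).
  - exact: fset_uniq.
  - by move=> h h' _ _ /mulgI/invg_inj.
  - move=> h hF _; rewrite mem_undup invgM invgK mulgVK hF andbT.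
    by apply/allpairsP; exists (x, h).
have Zinj x : injective (fun g => g^-1 * f x).
  by move=> g g' /mulIg/invg_inj.
(* A point of [V g] leaves it under [s] either because it leaves [O] ([P]) or because its image
   leaves the translate of [F] ([Q]). *)
have bdV s : s \in L -> (c * k * \sum_(g <- Z) bdry (V g) s <= 2 * (#|` O| * #|` F|))%N.
  move=> sL.
  have : (\sum_(g <- Z) bdry (V g) s <=
      bdry O s * #|` F| + \sum_(x <- O) bdry F ((f x)^-1 * f (x * s)))%N.
    pose P (x : X) (g : Y) := (x * s \notin O) && (g^-1 * f x \in F).
    pose Q (x : X) (g : Y) := (g^-1 * f x \in F) && (g^-1 * f (x * s) \notin F).
    have -> : (bdry O s * #|` F| + \sum_(x <- O) bdry F ((f x)^-1 * f (x * s)) =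
       \sum_(x <- O) (((x * s)%g \notin O) * #|` F| + bdry F ((f x)^-1 * f (x * s))))%N.
      by rewrite big_split /= -big_distrl /= /bdry count_big.
    apply: (@leq_trans (\sum_(x <- O) (count (P x) Z + count (Q x) Z))%N).
      have E g : bdry (V g) s = count (fun x => (g^-1 * f x \in F) && (x * s \notin V g)) O.
        rewrite -card_fset_count /bdry -card_fset_count; congr (#|` _|).
        by apply/fsetP => x; rewrite !inE /= andbA.
      under eq_bigr do rewrite E count_big.
      rewrite exchange_big; apply: leq_sum => x _.
      rewrite !count_big -big_split /=; apply: leq_sum => g _.
      by rewrite !inE /P /Q /=; case: (x * s \in O); case: (_ \in F) => //=; case: (_ \in F).
    apply: leq_sum => x _; apply: leq_add.
      rewrite /P; case: (x * s \notin O) => /=; last by rewrite count_pred0.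
      rewrite mul1n -[leqRHS]count_predT.
      apply: (@leq_count_inj _ _ _ _ _ _ (fun g => g^-1 * f x)).
      - exact: undup_uniq.
      - by move=> g g' _ _ /(@Zinj x).
      - by move=> g _ ->.
    apply: (@leq_count_inj _ _ _ _ _ _ (fun g => g^-1 * f x)).
    - exact: undup_uniq.
    - by move=> g g' _ _ /(@Zinj x).
    - by move=> g _ /andP[-> ]; rewrite -mulgA mulVKg => ->.
  move=> /(leq_mul (leqnn (c * k)))/leq_trans; apply.
  rewrite mulnDr mul2n -addnn; apply: leq_add.
    by rewrite mulnA leq_mul2r OL ?orbT.
  rewrite -sum1_size big_distrr big_distrl /=; apply: leq_sum => x _.
  by rewrite mul1n; apply/FL/L'P.
have : (\sum_(g <- Z) \sum_(s <- L) k * bdry (V g) s < \sum_(g <- Z) #|` V g|)%N.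
  apply: leq_trans sumV; rewrite ltnNge; apply/negP => bad.
  have : (c * \sum_(g <- Z) \sum_(s <- L) k * bdry (V g) s
      <= 2 * size L * (#|` O| * #|` F|))%N.
    rewrite exchange_big /= [in leqRHS]mulnAC mulnC -[X in (_ <= _ * X)%N]sum1_size.
    rewrite mulnC !big_distrr /= big_seq [leqRHS]big_seq; apply: leq_sum => s sL.
    rewrite muln1; apply: leq_trans (bdV s sL).
    by rewrite -big_distrr /= mulnA.
  apply/negP; rewrite -ltnNge; apply: leq_trans (leq_mul (leqnn c) bad).
  by rewrite ltn_pmul2r // muln_gt0 O0.
move=> /ltn_sum_exists[g _ lt]; exists (V g); [split|].
- exact: leq_trans lt.
- move=> s sL; apply/ltnW; apply: leq_ltn_trans lt.
  by rewrite [leqRHS](big_rem s sL) leq_addr.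
rewrite -mulnA; apply: leq_trans (leq_mul (leqnn m) Fpsi).
have VD : {in V g, forall x, f x \in [seq g * h | h <- F]}.
  by move=> x; rewrite !inE /= => /andP[_ xF]; apply/mapP; exists (g^-1 * f x); rewrite ?mulVKg.
rewrite -count_predT (count_partition _ _ VD); last first.
  by rewrite map_inj_uniq ?fset_uniq //; exact: mulgI.
rewrite big_map mulnC -sum1_size big_distrl /=; apply: leq_sum => h _; rewrite mul1n.
rewrite -size_filter; apply: (fm (g * h)); first by rewrite filter_uniq ?fset_uniq.
by move=> x; rewrite mem_filter /= => /andP[/andP[/eqP]].
Qed.

End Coarse.

(** * Comparison of iterated exponentials *)

Section Asymptotics.
Local Open Scope nat_scope.
Implicit Types (f g : nat -> nat) (a b n p : nat).

(** With q = p + 1, n + 1 is at most q 2^(n/q), so (n + 1)^q is at most q^q 2^n; the extra factor n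
    + 1 pays for [D] and q^q. *)
Lemma poly_lt_exp D p : exists N, forall n, N <= n -> D * n.+1 ^ p < 2 ^ n.
Proof.
pose q := p.+1; exists (D * q ^ q) => n Nn.
have q0 : 0 < q ^ q by rewrite expn_gt0.
rewrite -(ltn_pmul2r q0).
apply: (@leq_trans (n.+1 ^ q)).
  have -> : n.+1 ^ q = n.+1 * n.+1 ^ p by rewrite expnS.
  by rewrite mulnAC ltn_pmul2r ?expn_gt0 // ltnS.
apply: (@leq_trans ((2 ^ (n %/ q) * q) ^ q)).
  rewrite leq_exp2r //; apply: (@leq_trans ((n %/ q).+1 * q)).
    exact: ltn_ceil.
  by rewrite leq_mul2r ltn_expl // orbT.
by rewrite expnMn leq_mul2r -expnM leq_pexp2l ?orbT // leq_trunc_div.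
Qed.

Lemma leq_expl m n p : m <= n -> m ^ p <= n ^ p.
Proof. by case: p => // p mn; rewrite leq_exp2r. Qed.

(** [f] eventually exceeds every multiple of g log g, with [e] an upper bound for the binary
    logarithm of g. *)
Definition dominates f g := forall M, exists k0, forall k, k0 <= k ->
  exists2 e, g k <= 2 ^ e & M * (g k).+1 * e.+1 <= f k.

Lemma dominates_step f g : dominates f g ->
  dominates (fun k => 2 ^ (f k %/ 8)) (fun k => g k ^ (g k).+1).
Proof.
(* For the new logarithm bound [e'] = e (g + 1), the quantity to beat is at most 2^(M + 2 e' + 1),
   and 8 (M + 2 e' + 1) is below 16 (M + 1) (g + 1) (e + 1). *)
move=> fg M; have [k0 fgk] := fg (8 * M.+1.*2); exists k0 => k /fgk[e ge fe].
exists (e * (g k).+1); first by rewrite expnM leq_exp2r.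
set e' := e * _.
have g'e : (g k ^ (g k).+1).+1 <= 2 ^ e'.+1.
  by apply: (@leq_ltn_trans (2 ^ e')); rewrite ?ltn_exp2l // /e' expnM leq_exp2r.
have e'e : e'.+1 <= 2 ^ e' by exact: ltn_expl.
have Me : M <= 2 ^ M by apply/ltnW/ltn_expl.
apply: leq_trans (leq_mul (leq_mul Me g'e) e'e) _.
rewrite -!expnD leq_pexp2l // leq_divRL //.
apply: leq_trans fe; rewrite /e' -!addnn; nia.
Qed.

Lemma dominates_exp f g : dominates f g -> dominates (fun k => 2 ^ (f k %/ 8)) g.
Proof.
move=> fg M; have [k0 fgk] := fg (8 * M); exists k0 => k /fgk[e ge fe].
exists e => //; apply: leq_trans (ltnW (ltn_expl _ (isT : 1 < 2))) _.
by rewrite leq_pexp2l // leq_divRL // mulnC !mulnA.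
Qed.

Lemma dominates_poly a b C : b < a -> dominates (fun k => k ^ a) (fun k => (C * k) ^ b).
Proof.
move=> ba M.
have [N hN] := poly_lt_exp (2 * M * C.+1 ^ b * (b * C + b).+1) 1.
exists (2 ^ N) => k Nk.
have k0 : 0 < k by apply: leq_trans Nk; rewrite expn_gt0.
have /andP[nk kn] := trunc_log_bounds (isT : 1 < 2) k0.
set n := trunc_log 2 k in nk kn.
have Nn : N <= n by apply: trunc_log_max.
(* As [n] is the integer part of log k, this exceeds the logarithm of (C k)^b. It grows like log k,
   and the spare factor [k] of k^a outgrows it. *)
exists ((C + n.+1) * b).
  rewrite expnM; apply: leq_expl.
  by rewrite expnD leq_mul ?(ltnW kn) // ltnW // ltn_expl.
have := hN n Nn; rewrite expn1 => /ltnW hn.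
apply: (@leq_trans (k ^ b.+1)); last by rewrite leq_pexp2l.
rewrite expnS; apply: leq_trans (leq_mul (leq_trans hn nk) (leqnn _)).
have Ck : ((C * k) ^ b).+1 <= 2 * C.+1 ^ b * k ^ b.
  rewrite -mulnA -expnMn mul2n -addnn -addn1 leq_add ?expn_gt0 ?muln_gt0 ?k0 //.
  by apply: leq_expl; rewrite leq_mul2r leqnSn orbT.
apply: (@leq_trans (M * (2 * C.+1 ^ b * k ^ b) * ((C + n.+1) * b).+1)).
  by rewrite leq_mul // leq_mul2l Ck orbT.
have : ((C + n.+1) * b).+1 <= (b * C + b).+1 * n.+1 by nia.
move: (C.+1 ^ b) (k ^ b) ((C + n.+1) * b).+1 ((b * C + b).+1) => u v w z wz.
apply: (@leq_trans (M * (2 * u * v) * (z * n.+1))); first by rewrite leq_mul2l wz orbT.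
by lia.
Qed.

Lemma dominates_exp_poly a b C : 0 < a ->
  dominates (fun k => 2 ^ (k ^ a %/ 8)) (fun k => (C * k) ^ b).
Proof.
move=> a0 M.
have [N hN] := poly_lt_exp (M * 4 * (C.+1 * 8) ^ (b + b)) (b + b).
exists (8 * N) => k Nk.
(* The crude bound log x <= x is good enough against an exponential. *)
exists ((C * k) ^ b); first by apply/ltnW/ltn_expl.
pose q := k %/ 8.
have Nq : N <= q by rewrite leq_divRL // mulnC.
apply: (@leq_trans (2 ^ q)); last first.
  rewrite leq_pexp2l // leq_div2r // -{1}(expn1 k).
  by case: k {Nk q Nq} => [|k]; rewrite ?exp0n // leq_pexp2l.
apply: leq_trans (ltnW (hN q Nq)).
have Ck : ((C * k) ^ b).+1 <= 2 * (C.+1 * 8 * q.+1) ^ b.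
  rewrite mul2n -addnn -addn1 leq_add ?expn_gt0 ?muln_gt0 //.
  apply: leq_expl; rewrite -mulnA; apply: leq_mul; first exact: leqnSn.
  by rewrite mulnC; apply/ltnW; exact: ltn_ceil.
rewrite -!mulnA; apply: (@leq_trans (M * ((2 * (C.+1 * 8 * q.+1) ^ b) * (2 * (C.+1 * 8 * q.+1) ^ b)))).
  by rewrite leq_mul2l leq_mul ?orbT.
rewrite !expnD !expnMn; move: (C.+1 ^ b) (8 ^ b) (q.+1 ^ b) => u v w.
by lia.
Qed.

Definition low_tower a n : nat -> nat :=
  iter n (fun f k => 2 ^ (f k %/ 8)) (fun k => k ^ a).
Definition up_tower b n : nat -> nat :=
  iter n (fun f k => f k ^ (f k).+1) (fun k => k ^ b).

(** Common levels are peeled from both towers until the right one is a polynomial; surplus levels on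
    the left only enlarge it. *)
Lemma dominates_tower a b n m C : 0 < a -> (m < n) || (n == m) && (b < a) ->
  dominates (low_tower a n) (fun k => up_tower b m (C * k)).
Proof.
move=> a0; elim: m n => [|m IH] [|n] //=.
- by rewrite /= => ba; exact: dominates_poly.
- move=> _; elim: n => [|n IHn]; first exact: dominates_exp_poly.
  exact: dominates_exp.
- by move=> lt; apply: (dominates_step (IH n lt)).
Qed.

Lemma tower_le a b n m C M : 0 < a ->
  (forall k, 0 < k -> low_tower a n k <= M * up_tower b m (C * k)) ->
  n < m \/ n = m /\ a <= b.
Proof.
move=> a0 le.
have [lt|] := boolP ((m < n) || (n == m) && (b < a)); last by lia.
have [k0 /(_ k0.+1 (leqnSn _))[e _]] := dominates_tower C a0 lt M.+1.
have := le k0.+1 isT.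
move: (low_tower _ _ _) (up_tower _ _ _) => l u h1 h2.
suff : M * u < l by rewrite ltnNge h1.
by apply: leq_trans h2; nia.
Qed.

End Asymptotics.

(** * Word metrics and polynomial growth *)

Lemma finite_bounded (T : choiceType) (N : T -> nat) (A : set T) : finite_set A ->
  exists C, forall x, A x -> N x <= C.
Proof.
move=> Afin; exists (\sum_(x <- fset_set A) N x) => x Ax.
have xA : x \in (fset_set A : seq T) by rewrite /= in_fset_set // inE.
by rewrite (big_rem x xA) leq_addr.
Qed.

Section Balls.
Variables (G : groupType) (S : genset G).
Local Notation len := (word_length S).

Lemma len_word w : is_word S w -> len (\prod_(s <- w) s) <= size w.
Proof.
move=> Sw; rewrite /word_length; case: ex_minnP => n _; apply.
by apply/asboolP; exists w.
Qed.

Lemma len_spell g : exists w, [/\ is_word S w, size w = len g & \prod_(s <- w) s = g].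
Proof. by rewrite /word_length; case: ex_minnP => n /asboolP. Qed.

Lemma len1 : len 1 = 0.
Proof. by apply/eqP; rewrite -leqn0; have := @len_word [::] isT; rewrite big_nil. Qed.

Lemma len_eq0 g : len g = 0 -> g = 1.
Proof. by case: (len_spell g) => w [_ <- <-] /size0nil ->; rewrite big_nil. Qed.

Lemma lenM g h : (len (g * h) <= len g + len h)%N.
Proof.
have [v [Sv <- <-]] := len_spell g; have [w [Sw <- <-]] := len_spell h.
rewrite -big_cat -size_cat; apply: len_word.
by rewrite /is_word all_cat; apply/andP.
Qed.

Lemma lenV g : len g^-1 <= len g.
Proof.
have [w [Sw <- <-]] := len_spell g.
have -> : (\prod_(s <- w) s)^-1 = \prod_(s <- [seq s^-1 | s <- rev w]) s.
  by rewrite big_map prodgV revK.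
have -> : size w = size (map (fun s => s^-1) (rev w)) by rewrite size_map size_rev.
apply: len_word; rewrite /is_word all_map all_rev; apply: sub_all Sw => s /=.
by rewrite invgK orbC.
Qed.

Definition letters : seq G := S ++ [seq s^-1 | s <- S].

Lemma lettersP s : (s \in letters) = (s \in (S : seq G)) || (s^-1 \in (S : seq G)).
Proof.
rewrite mem_cat; congr (_ || _); apply/mapP/idP => [[t tS ->]|sS].
  by rewrite invgK.
by exists s^-1; rewrite ?invgK.
Qed.

Lemma word_ball_finite r : finite_set (word_ball S r).
Proof.
elim: r => [|r IH].
  apply: (@sub_finite_set _ _ [set 1]%classic); last exact: finite_set1.
  by move=> g /=; rewrite /word_ball /= leqn0 => /eqP/len_eq0.
apply: (@sub_finite_set _ _ ([set 1] `|`
   [set s * g | s in [set` letters] & g in word_ball S r])%classic).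
  move=> g /=; rewrite /word_ball /=; have [w [Sw <- <-]] := len_spell g.
  case: w Sw => [|s w] /=; first by rewrite big_nil; left.
  move=> /andP[sS Sw] ws; right; exists s; first by rewrite /= lettersP.
  exists (\prod_(s <- w) s); last by rewrite big_cons.
  exact: leq_trans (len_word Sw) _.
rewrite finite_setU; split; first exact: finite_set1.
by apply: finite_image2 => //; exact: finite_seq.
Qed.

Definition ball r : {fset G} := fset_set (word_ball S r).

Lemma mem_ball r g : (g \in ball r) = (len g <= r).
Proof.
rewrite /ball in_fset_set; last exact: word_ball_finite.
by apply/idP/idP; rewrite inE.
Qed.

Lemma ball_sub r r' : r <= r' -> (ball r `<=` ball r')%fset.
Proof.
move=> rr; apply/fsubsetP => g; rewrite !mem_ball => /leq_trans; exact.
Qed.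

Lemma bdry_len (U : {fset G}) g k b : {in letters, forall s, k * bdry U s <= b} ->
  k * bdry U g <= len g * b.
Proof.
move=> Ub; have [w [Sw ws wg]] := len_spell g; rewrite -ws -{1}wg.
by apply: bdry_word Ub _ => s /(allP Sw); rewrite lettersP.
Qed.

End Balls.

Section Growth.
Variables (G : groupType) (S : genset G) (a c : nat).
Hypothesis c0 : 0 < c.
Hypothesis growth : forall r, 0 < r ->
  (r ^ a <= c * #|` ball S r| /\ #|` ball S r| <= c * r ^ a)%N.

(* Coulhon--Saloff-Coste: a random translation by the ball of radius M k moves half of U
   off itself, while each letter moves few points. *)
Lemma folner_lower_growth : folner_lower G (fun k => k ^ a)%N.
Proof.
have [->|a0] := posnP a.
  by exists [::], 1%N => // k U _ [U0 _]; rewrite expn0.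
(* As [a] is positive, the ball of radius M k has at least (2 c k)^a / c >= 2 k^a elements, more
   than twice the size assumed for [U]. *)
pose M := (2 * c)%N; have M0 : 0 < M by rewrite muln_gt0.
exists (letters S), (2 * M).+1%N => // k U k0 [U0 US].
rewrite leqNgt; apply/negP => Uk.
have big : (2 * #|` U| < #|` ball S (M * k)|)%N.
  have [|h _] := growth (r := (M * k)%N); first by rewrite muln_gt0 M0.
  rewrite -(ltn_pmul2l c0); apply: leq_trans h.
  rewrite mulnA [(c * 2)%N]mulnC -/M expnMn; apply: (@leq_trans (M * k ^ a)%N).
    by rewrite ltn_pmul2l.
  by rewrite leq_mul2r -{1}(expn1 M) leq_pexp2l ?orbT.
pose Q g := count (fun x => x * g \in U) U.
have sumQ : (\sum_(g <- ball S (M * k)) Q g <= #|` U| * #|` U|)%N.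
  under eq_bigr do rewrite /Q count_big.
  rewrite exchange_big -[X in (_ <= X * _)%N]sum1_size big_distrl /=; apply: leq_sum => x _.
  rewrite mul1n -count_big -[leqRHS]count_predT.
  apply: (@leq_count_inj _ _ _ _ _ _ (fun g => x * g)).
  - exact: fset_uniq.
  - by move=> g h _ _ /mulgI.
  - by move=> g _ ->.
have [g gB gQ] : exists2 g, g \in (ball S (M * k) : seq G) & (2 * Q g < #|` U|)%N.
  apply: ltn_sum_exists; rewrite -[ltnLHS]big_distrr /=.
  apply: leq_ltn_trans (leq_mul (leqnn 2) sumQ) _.
  apply: (@leq_trans (#|` ball S (M * k)| * #|` U|)%N).
    by rewrite mulnA ltn_pmul2r.
  by rewrite -sum1_size big_distrl /=; apply: leq_sum => x _; rewrite mul1n.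
have Qbd : (Q g + bdry U g = #|` U|)%N by rewrite /Q /bdry -(count_predC (fun x => x * g \in U) U).
have : ((2 * M).+1 * k * bdry U g <= M * k * #|` U|)%N.
  apply: leq_trans (bdry_len g US) _; rewrite leq_mul2r; apply/orP; right.
  by rewrite -mem_ball.
rewrite mulnAC [in leqRHS]mulnAC leq_pmul2r //; apply/negP; rewrite -ltnNge.
have arith n q e : (q + e = n -> 2 * q < n -> M * n < (2 * M).+1 * e)%N by nia.
exact: arith Qbd gQ.
Qed.

(* If no ball of radius between k l and (T + 1) k l were a Følner set, the volume would
   grow by the factor (1 + 1/k)^(T k) >= 2^T over this range. *)
Lemma folner_upper_growth : 0 < a -> folner_upper G (fun k => k ^ a)%N.
Proof.
move=> a0 L.
pose l := (\sum_(g <- L) word_length S g).+1.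
have Ll g : g \in L -> (word_length S g <= l)%N.
  by move=> gL; rewrite /l (big_rem g gL) -addnS leq_addr.
(* The growth bounds allow volume to increase by at most c^2 (T + 1)^a between the radii k l and (T
   + 1) k l. *)
have [T Thuge] : exists T, (c * c * T.+1 ^ a < 2 ^ T)%N.
  by have [N hN] := poly_lt_exp (c * c) a; exists N; exact: hN.
exists (c * (T.+1 * l))%N => [|k k0]; first by rewrite muln_gt0 c0.
(* Steps of [l], so that one step in radius contains the translates by every letter of [L]. *)
pose r i := (k * l + i * l)%N; pose B i := #|` ball S (r i)|.
have kl0 : (0 < k * l)%N by rewrite muln_gt0 k0.
have [i iT Bi] : exists2 i, (i < T * k)%N & (k * (B i.+1 - B i) <= B i)%N.
  apply: contrapT => no.
  have step i : (i < T * k)%N -> (k.+1 * B i <= k * B i.+1)%N.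
    move=> iT; have : ~~ (k * (B i.+1 - B i) <= B i)%N.
      by apply/negP => Bi; apply: no; exists i.
    by rewrite -ltnNge mulnBr; nia.
  have steps i : (i <= T * k)%N -> (k.+1 ^ i * B 0 <= k ^ i * B i)%N.
    elim: i => // i IH iT; rewrite !expnS -mulnA.
    apply: leq_trans (leq_mul (leqnn _) (IH (ltnW iT))) _.
    by rewrite mulnCA (mulnC k) -mulnA leq_mul2l step ?orbT.
  have double : (2 * k ^ k <= k.+1 ^ k)%N.
    have bernoulli n : (k ^ n * (k + n) <= k.+1 ^ n * k)%N.
      elim: n => [|n IH]; first by rewrite !expn0 addn0.
      rewrite !expnS -[leqRHS]mulnA; apply: leq_trans (leq_mul (leqnn _) IH).
      by move: (k ^ n)%N => u; nia.
    by have := bernoulli k; rewrite addnn -mul2n mulnA leq_pmul2r // mulnC.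
  have := steps (T * k)%N (leqnn _).
  have : (2 ^ T * k ^ (T * k) <= k.+1 ^ (T * k))%N.
    by rewrite mulnC [(T * k)%N]mulnC !expnM -expnMn mulnC leq_expl.
  have kTk : (0 < k ^ (T * k))%N by rewrite expn_gt0 k0.
  move=> h1 h2; have {h1 h2 kTk} : (2 ^ T * B 0 <= B (T * k))%N.
    rewrite -(leq_pmul2l kTk) mulnA; apply: leq_trans h2.
    by rewrite leq_mul2r mulnC h1 orbT.
  have [g1 _] := growth kl0.
  have rT : r (T * k)%N = (T.+1 * (k * l))%N by rewrite /r; lia.
  have g2 : (B (T * k) <= c * (T.+1 * (k * l)) ^ a)%N.
    by rewrite -rT; apply: (growth _).2; rewrite rT muln_gt0.
  apply/negP; rewrite -ltnNge.
  rewrite expnMn in g2; apply: leq_ltn_trans g2 _.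
  rewrite -(ltn_pmul2l c0); apply: (@leq_trans (2 ^ T * (k * l) ^ a)%N).
    by rewrite !mulnA ltn_pmul2r // expn_gt0 kl0.
  by rewrite mulnCA leq_mul2l /B /r mul0n addn0 g1 orbT.
exists (ball S (r i)); [split|].
- by rewrite cardfs_gt0; apply/fset0Pn; exists 1; rewrite mem_ball len1.
- move=> g gL; apply: leq_trans Bi; rewrite leq_mul2l; apply/orP; right.
  have rS : (r i.+1 = r i + l)%N by rewrite /r; lia.
  rewrite /B -cardfsDS; last by apply: ball_sub; rewrite rS leq_addr.
  rewrite /bdry -[leqRHS]count_predT.
  apply: (@leq_count_inj _ _ _ _ _ _ (fun x => x * g)).
  + exact: fset_uniq.
  + by move=> x y _ _ /mulIg.
  + move=> x; rewrite mem_ball => xr xg; rewrite in_fsetD xg mem_ball rS.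
    by rewrite andbT; apply: leq_trans (lenM _ _ _) _; rewrite leq_add ?Ll.
- have ri : (r i <= T.+1 * l * k)%N.
    have : (i * l <= T * k * l)%N by rewrite leq_mul2r (ltnW iT) orbT.
    by rewrite /r; lia.
  have [|_ g2] := growth (r := r i); first by rewrite /r addn_gt0 kl0.
  apply: leq_trans g2 _; rewrite -mulnA expnMn; apply: leq_mul.
    by rewrite -{1}(expn1 c) leq_pexp2l.
  exact: leq_expl.
Qed.

End Growth.

(** * From real-valued metric conditions to coarse maps *)

Section RealBridge.
Variable R : realType.
Local Open Scope ring_scope.

Lemma nat_above (x : R) : exists n : nat, x <= n%:R.
Proof.
exists (Num.bound `|x|); apply: le_trans (ler_norm x) (ltW _).
exact: archi_boundP.
Qed.

Lemma growth_degree_nat (G : groupType) a : growth_degree G R a ->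
  exists (S : genset G) (c : nat), (0 < c)%N /\ forall r, (0 < r)%N ->
    (r ^ a <= c * #|` ball S r| /\ #|` ball S r| <= c * r ^ a)%N.
Proof.
move=> [S [C C0 growth]]; have [c Cc] := nat_above C.
have c0 : (0 < c)%N by rewrite -(ltr_nat R); apply: lt_le_trans Cc.
exists S, c; split=> // r /growth[k [rk lek kle]].
rewrite (card_fset_set rk) -!(ler_nat R) !natrM natrX; split.
  apply: le_trans (_ : C * k%:R <= _); last by rewrite ler_wpM2r.
  by rewrite -ler_pdivrMl.
by apply: le_trans kle _; rewrite ler_wpM2r // exprn_ge0.
Qed.

Variables (X Y : groupType) (S : genset X) (T : genset Y) (f : X -> Y).

Lemma dist_eq0 (G : groupType) (U : genset G) (x : G) : word_dist R U x x = 0.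
Proof. by rewrite /word_dist mulVg len1. Qed.

Lemma word_dist_sym (G : groupType) (U : genset G) (x y : G) :
  word_dist R U x y = word_dist R U y x.
Proof.
have le u v : (word_length U (u^-1 * v)%g <= word_length U (v^-1 * u)%g)%N.
  by rewrite -{1}(invgK v) -invgM lenV.
by rewrite /word_dist; congr _%:R; apply/eqP; rewrite eqn_leq !le.
Qed.

Lemma word_dist_triangle (G : groupType) (U : genset G) (y x z : G) :
  word_dist R U x z <= word_dist R U x y + word_dist R U y z.
Proof.
rewrite /word_dist -natrD ler_nat; apply: leq_trans (lenM _ _ _).
by rewrite -mulgA mulVKg.
Qed.

Lemma coarse_large_scale (C K : R) :
  (forall x x', word_dist R T (f x) (f x') <= C * word_dist R S x x' + K) ->
  coarse f.
Proof.
move=> fC s; have [n hn] := nat_above (C * (word_length S s)%:R + K).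
apply: sub_finite_set (word_ball_finite T n) => _ [x _ <-] /=.
rewrite /word_ball /= -(ler_nat R); apply: le_trans hn.
by have := fC x (x * s)%g; rewrite /word_dist mulKg.
Qed.

Lemma bounded_fibers_large_scale (n : nat) :
  (forall x x', f x = f x' -> word_length S (x^-1 * x')%g <= n)%N ->
  bounded_fibers f.
Proof.
move=> fn; exists #|` ball S n| => y [//|x l] ul fl.
apply: (@leq_size_inj _ _ _ _ (fun x' => (x^-1 * x')%g)) => //.
  by move=> u v _ _ /mulgI.
move=> x' x'l; rewrite mem_ball; apply: fn.
by rewrite !fl // mem_head.
Qed.

Lemma regular_coarse : regular_map (word_dist R S) (word_dist R T) f ->
  coarse f /\ bounded_fibers f.
Proof.
move=> [[C _ fC] [m _ fm]]; split.
  by apply: (@coarse_large_scale C 0) => x x'; rewrite addr0.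
exists m => y l ul fl; apply: leq_trans (geq_card_fset_set (fm y)).
have fin : finite_set (f @^-1` [set y])%classic.
  by apply/finite_set_leP; exists m.
apply: uniq_leq_size => // x xl; rewrite in_fset_set // inE /=; exact: fl.
Qed.

End RealBridge.

(** Displacements along the letters of a word telescope, and each is bounded by coarseness. [N] is a
    word length in one use and the sup norm of a lattice in another. *)
Lemma coarse_subadditive (X Y : groupType) (S : genset X) (f : X -> Y) (N : Y -> nat) :
  N 1 = 0 -> (forall g h, N (g * h)%g <= N g + N h)%N -> coarse f ->
  exists C, forall x x', (N ((f x)^-1 * f x')%g <= C * word_length S (x^-1 * x')%g)%N.
Proof.
move=> N1 NM cf.
have [C hC] : exists C, forall s, s \in letters S -> forall x,
    (N ((f x)^-1 * f (x * s))%g <= C)%N.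
  elim: (letters S) => [|s l [C hC]]; first by exists 0%N.
  have [D hD] := finite_bounded N (cf s).
  exists (maxn C D) => t; rewrite inE => /orP[/eqP->|tl] x; rewrite leq_max.
    by apply/orP; right; apply: hD; exists x.
  by rewrite hC.
exists C => x x'; rewrite -{1}(mulVKg x x')%g.
have [w [Sw <- <-]] := len_spell S (x^-1 * x')%g.
elim: w x Sw => [|s w IH] x /=; first by rewrite big_nil mulg1 mulVg N1.
move=> /andP[sS Sw]; rewrite big_cons mulgA mulnS.
have -> : ((f x)^-1 * f (x * s * \prod_(j <- w) j) =
  ((f x)^-1 * f (x * s)) * ((f (x * s))^-1 * f (x * s * \prod_(j <- w) j)))%g.
  by rewrite [RHS]mulgA mulgK.
apply: leq_trans (NM _ _) _; apply: leq_add; last exact: IH.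
by apply: hC; rewrite lettersP.
Qed.

Lemma growth_degree_gt0 (R : realType) (G : groupType) a : infinite_set [set: G] ->
  growth_degree G R a -> 0 < a.
Proof.
move=> infG /growth_degree_nat[S [c [c0 growth]]]; rewrite lt0n; apply/eqP => a0.
have [B _ cB] := infinite_set_fset c.+1 infG.
pose r := (\sum_(g <- B) word_length S g).+1.
have BB : (B `<=` ball S r)%fset.
  apply/fsubsetP => g gB; rewrite mem_ball /r (big_rem g gB) /=.
  by rewrite -addnS leq_addr.
have := leq_trans cB (fsubset_leq_card BB).
by have [//|_] := growth r; rewrite a0 muln1 leqNgt => /negP.
Qed.

(** * Coarse equivalences *)

Section CoarseEquivalence.
Implicit Types X Y Z : groupType.

Lemma finite_range_factor (T : choiceType) (U V : Type) (p : T -> U) (q : T -> V) (x0 : T) :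
  (forall x y, p x = p y -> q x = q y) -> finite_set (range p) -> finite_set (range q).
Proof.
move=> pq /(finite_image (fun z => q (xget x0 [set x | p x = z]%classic))).
apply: sub_finite_set => _ [x _ <-] /=; exists (p x); first by exists x.
by apply: pq; case: xgetP => [y _ //|/(_ x)/(_ erefl)].
Qed.

(** BiLipschitz equivalence of finitely generated groups, freed from the choice of generators. *)
Definition coarsely_equivalent X Y := exists (f : X -> Y) (g : Y -> X),
  [/\ cancel f g, cancel g f, coarse f & coarse g].

Lemma coarse_comp X Y Z (f : X -> Y) (g : Y -> Z) :
  coarse f -> coarse g -> coarse (g \o f).
Proof.
move=> cf cg s.
apply: (@sub_finite_set _ _ (\bigcup_(u in range (fun x => (f x)^-1 * f (x * s)))
  range (fun y => (g y)^-1 * g (y * u)))%classic); last exact: bigcup_finite.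
move=> _ [x _ <-] /=; exists ((f x)^-1 * f (x * s)); first by exists x.
by exists (f x) => //; rewrite mulVKg.
Qed.

Lemma coarsely_equivalent_sym X Y : coarsely_equivalent X Y -> coarsely_equivalent Y X.
Proof. by move=> [f [g [fK gK cf cg]]]; exists g, f. Qed.

Lemma coarsely_equivalent_trans Y X Z : coarsely_equivalent X Y ->
  coarsely_equivalent Y Z -> coarsely_equivalent X Z.
Proof.
move=> [f [g [fK gK cf cg]]] [f' [g' [fK' gK' cf' cg']]].
exists (f' \o f), (g \o g'); split; try exact: coarse_comp.
  exact: can_comp.
exact: can_comp.
Qed.

Section ShufflerMap.
Variables (X Y : groupType) (f : X -> Y) (g : Y -> X).
Hypotheses (fK : cancel f g) (gK : cancel g f).

Fact fsym_conj_finite (w : FSym X) : finite_set [set y | (f \o w \o g) y <> y]%classic.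
Proof.
apply: sub_finite_set (finite_image f (fsym_finite w)) => y /= wy.
by exists (g y); rewrite ?gK // => e; apply: wy; rewrite e gK.
Qed.

Definition fsym_conj (w : FSym X) : FSym Y :=
  MkFSym (can_comp (can_comp fK (fsym_funK w)) gK)
         (can_comp (can_comp fK (fsym_invK w)) gK) (fsym_conj_finite w).

Definition shuffler_map (x : Shuffler X) : Shuffler Y :=
  Semidirect (fsym_conj (lamps x)) (f (arrow x)).

(** The map [f] recentred at [h]: a bijection fixing the identity, with inverse [phi' h]. *)
Let phi h v := (f h)^-1 * f (h * v).
Let phi' h z := h^-1 * g (f h * z).
Let phiK h : cancel (phi h) (phi' h).
Proof. by move=> v; rewrite /phi /phi' mulVKg fK mulKg. Qed.
Let phi'K h : cancel (phi' h) (phi h).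
Proof. by move=> z; rewrite /phi /phi' mulVKg gK mulKg. Qed.

(** The displacement from [x] to [x * t] has arrow [phi h (arrow t)] and lamps the conjugate of [u]
    by [phi h], where h is the arrow of [x]. Both are determined by [phi h] on the finite list [l],
    and coarseness of [f] leaves finitely many possible values there. *)
Lemma coarse_shuffler_map : coarse f -> coarse shuffler_map.
Proof.
move=> cf t.
pose u := lamps t; pose l := arrow t :: fsupp u ++ map u (fsupp u).
pose p (x : Shuffler X) := [seq phi (arrow x) v | v <- l].
apply: (@finite_range_factor _ _ _ p _ 1); last first.
  rewrite /p; elim: (l) => [|v l' IH] /=.
    apply: sub_finite_set (finite_set1 [::]) => _ [x _ <-] //.
  have := finite_image2 (fun y s => y :: s) (cf v) IH.
  apply: sub_finite_set => _ [x _ <-] /=.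
  exists (phi (arrow x) v); first by exists (arrow x).
  by exists [seq phi (arrow x) v | v <- l'] => //; exists x.
have DE x : (shuffler_map x)^-1 * shuffler_map (x * t) =
    Semidirect ((shuffler_map x)^-1 * shuffler_map (x * t)).(lamps) (phi (arrow x) (arrow t)).
  by [].
have DlE x z : lamps ((shuffler_map x)^-1 * shuffler_map (x * t)) z =
    phi (arrow x) (u (phi' (arrow x) z)).
  rewrite /= /fsym_act_fun /= invgK mulVKg fK fsym_funK.
  by rewrite /fsym_act_fun /phi /phi'.
move=> x y /eq_in_map pxy; rewrite DE [RHS]DE; congr Semidirect; last first.
  by apply: pxy; rewrite mem_head.
apply: fsymP => z; rewrite !DlE.
pose h := arrow x; pose k := arrow y; rewrite -/h -/k.
have supp v : v \in fsupp u -> phi h v = phi k v /\ phi h (u v) = phi k (u v).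
  move=> vu; split; apply: pxy; rewrite inE mem_cat ?vu ?orbT //.
  by rewrite map_f // !orbT.
(* [phi h] and [phi k] map the support of [u] onto the same set with the same labels, so [z] is
   moved by both conjugates, equally, or by neither. *)
have [hz|hz] := boolP (phi' h z \in fsupp u).
  have [e1 e2] := supp _ hz.
  by rewrite e2; congr (phi k (u _)); rewrite -{2}[z](phi'K h) e1 phiK.
have [kz|kz] := boolP (phi' k z \in fsupp u).
  have [e1 _] := supp _ kz; move: hz.
  by rewrite -{1}[z](phi'K k) -e1 phiK kz.
by rewrite !fsuppP // !phi'K.
Qed.

End ShufflerMap.

Lemma shuffler_mapK X Y (f : X -> Y) (g : Y -> X) (fK : cancel f g) (gK : cancel g f) :
  cancel (shuffler_map fK gK) (shuffler_map gK fK).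
Proof.
move=> [w h]; congr Semidirect; last exact: fK.
by apply: fsymP => z /=; rewrite !fK.
Qed.

Lemma coarsely_equivalent_iter_Shuffler n X Y : coarsely_equivalent X Y ->
  coarsely_equivalent (iter n Shuffler X) (iter n Shuffler Y).
Proof.
move=> XY; elim: n => //= n [f [g [fK gK cf cg]]].
by exists (shuffler_map fK gK), (shuffler_map gK fK); split;
  [exact: shuffler_mapK | exact: shuffler_mapK
  | exact: coarse_shuffler_map | exact: coarse_shuffler_map].
Qed.

Section Metric.
Variables (R : realType) (X Y : groupType) (S : genset X) (T : genset Y).
Local Open Scope ring_scope.
Let dS := word_dist R S.
Let dT := word_dist R T.

Lemma coarsely_equivalent_biLipschitz : coarsely_equivalent X Y ->
  biLipschitz_equivalent dS dT.
Proof.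
move=> [f [g [fK gK cf cg]]]; exists f; split; last by exists g.
have [C hC] := coarse_subadditive S (len1 T) (lenM T) cf.
have [D hD] := coarse_subadditive T (len1 S) (lenM S) cg.
pose M := (C + D).+1.
have M0 : 0 < M%:R :> R by rewrite ltr0n.
exists M%:R, 0; split; rewrite ?ler1n //.
  move=> x x'; rewrite subr0 addr0 ler_pdivrMl //.
  rewrite /dS /dT /word_dist -!natrM !ler_nat; split.
    have := hD (f x) (f x'); rewrite !fK => /leq_trans; apply.
    by rewrite leq_mul2r /M -addSn leq_addl orbT.
  apply: leq_trans (hC x x') _.
  by rewrite leq_mul2r /M -addnS leq_addr orbT.
by move=> y; exists (g y); rewrite gK /dT dist_eq0.
Qed.

Lemma coarse_regular (f : X -> Y) (g : Y -> X) :
  cancel f g -> coarse f -> regular_map dS dT f.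
Proof.
move=> fK cf; have [C hC] := coarse_subadditive S (len1 T) (lenM T) cf; split.
  exists C.+1%:R; first by rewrite ltr0n.
  move=> x x'; rewrite /dS /dT /word_dist -natrM ler_nat.
  by apply: leq_trans (hC x x') _; rewrite leq_mul2r leqnSn orbT.
exists 1%N => // y; apply: (@card_le_trans _ _ _ [set g y]).
  by apply: subset_card_le => x /= <-; rewrite fK.
by have := @card_set1 _ (g y); rewrite card_eq_le => /andP[].
Qed.

(** Fibers of a quasi-isometry have bounded diameter, hence bounded size; the converse direction is
    a quasi-inverse [g], choosing for each y a point whose image lies within [K]. *)
Lemma quasi_isometric_coarse : quasi_isometric dS dT ->
  (exists f : X -> Y, coarse f /\ bounded_fibers f) /\
  (exists g : Y -> X, coarse g /\ bounded_fibers g).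
Proof.
move=> [f [C [K [C1 K0 fC fK]]]].
have C0 : 0 < C by exact: lt_le_trans C1.
have invC d e : C^-1 * d - K <= e -> d <= C * (e + K).
  by move=> h; rewrite -ler_pdivrMl // -lerBlDr.
split.
  exists f; split; first by apply: (@coarse_large_scale R _ _ S T f C K) => x x'; case: (fC x x').
  have [n hn] := nat_above (C * K).
  apply: (@bounded_fibers_large_scale _ _ S f n) => x x' fxx.
  rewrite -(ler_nat R); apply: le_trans hn; rewrite -[leRHS]/(C * K).
  have [/invC + _] := fC x x'; rewrite fxx [dT _ _]dist_eq0 add0r; exact.
have [g gP] := choice fK.
exists g.
have K' y : dT y (f (g y)) <= K by exact: gP.
have main y y' : dS (g y) (g y') <= C * dT y y' + C * (K + K + K).
  have [/invC h _] := fC (g y) (g y').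
  apply: le_trans h _; rewrite -mulrDr ler_wpM2l ?(ltW C0) //.
  have h1 : dT (f (g y)) (f (g y')) <= dT (f (g y)) y + dT y (f (g y')) by exact: word_dist_triangle.
  have h2 : dT y (f (g y')) <= dT y y' + dT y' (f (g y')) by exact: word_dist_triangle.
  have := K' y; have := K' y'; rewrite {2}/dT word_dist_sym -/dT.
  by move: h1 h2; rewrite -/dT; lra.
split; first exact: (@coarse_large_scale R _ _ T S g C _ main).
have [n hn] := nat_above (K + K).
apply: (@bounded_fibers_large_scale _ _ T g n) => y y' gyy.
rewrite -(ler_nat R); apply: le_trans hn; rewrite -[leLHS]/(dT y y').
apply: le_trans (word_dist_triangle _ T (f (g y)) _ _) _; apply: lerD => //.
by rewrite gyy word_dist_sym.
Qed.

End Metric.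
End CoarseEquivalence.

(** * Free abelian groups *)

(* The additive group of [int], in multiplicative notation. *)
Definition zgroup : Type := int.
HB.instance Definition _ := Choice.on zgroup.
Definition zgroup_mul (x y : zgroup) : zgroup := (x + y)%R.
Definition zgroup_inv (x : zgroup) : zgroup := (- x)%R.
Definition zgroup_one : zgroup := (0 : int)%R.
Fact zgroup_mulA : associative zgroup_mul. Proof. exact: addrA. Qed.
Fact zgroup_mul1 : left_id zgroup_one zgroup_mul. Proof. exact: add0r. Qed.
Fact zgroup_1mul : right_id zgroup_one zgroup_mul. Proof. exact: addr0. Qed.
Fact zgroup_mulV : left_inverse zgroup_one zgroup_inv zgroup_mul. Proof. exact: addNr. Qed.
Fact zgroup_Vmul : right_inverse zgroup_one zgroup_inv zgroup_mul. Proof. exact: addrN. Qed.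
HB.instance Definition _ := isGroup.Build zgroup
  zgroup_mulA zgroup_mul1 zgroup_1mul zgroup_mulV zgroup_Vmul.

Definition unit_mul (_ _ : unit) := tt.
Definition unit_inv (_ : unit) := tt.
Fact unit_mulA : associative unit_mul. Proof. by []. Qed.
Fact unit_mul1 : left_id tt unit_mul. Proof. by case. Qed.
Fact unit_1mul : right_id tt unit_mul. Proof. by case. Qed.
Fact unit_mulV : left_inverse tt unit_inv unit_mul. Proof. by []. Qed.
Fact unit_Vmul : right_inverse tt unit_inv unit_mul. Proof. by []. Qed.
HB.instance Definition _ := isGroup.Build unit
  unit_mulA unit_mul1 unit_1mul unit_mulV unit_Vmul.

(** Z^r built one factor at a time, so that the last coordinate is at hand for inductions on the
    rank and for the division that absorbs coset indices. *)
Definition lattice (r : nat) : groupType :=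
  iter r (fun G : groupType => (G * zgroup)%type : groupType) (unit : groupType).

Section IntegerPowers.
Variable G : groupType.
Implicit Types (g : G) (e : int).

Definition zexpg g e : G := match e with Posz n => g ^+ n | Negz n => g ^- n.+1 end.

Lemma zexpgB g (m n : nat) : zexpg g (m%:Z - n%:Z)%R = g ^+ m * g ^- n.
Proof.
have cgg (i j : nat) : commute (g ^+ i) (g ^+ j) by apply: commuteX2; exact: commute_refl.
have [nm|/ltnW mn] := leqP n m; first by rewrite subzn // /= expgnFr.
rewrite -opprB subzn //.
have -> : zexpg g (- (n - m)%N%:Z)%R = g ^- (n - m).
  by case: (n - m) => [|k]; rewrite ?oppr0 /= ?invg1.
by rewrite expgnFr // invgF.
Qed.

Lemma zexpgD g : {morph zexpg g : e e' / (e + e')%R >-> e * e'}.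
Proof.
have intB e : exists m n : nat, e = (m%:Z - n%:Z)%R.
  case: e => n; first by exists n, 0; rewrite subr0.
  by exists 0, n.+1; rewrite NegzE sub0r.
move=> e e'; have [m [n ->]] := intB e; have [m' [n' ->]] := intB e'.
have cgg (i j : nat) : commute (g ^+ i) (g ^+ j) by apply: commuteX2; exact: commute_refl.
rewrite addrACA -opprD -!PoszD !zexpgB !expgnDr invgM -!mulgA; congr (_ * _).
have -> : g ^- n * (g ^+ m' * g ^- n') = (g ^+ m' * g ^- n') * g ^- n.
  apply: commute_sym; apply: commuteV; apply: commute_sym.
  by apply: commuteM; [|apply: commuteV].
by rewrite mulgA.
Qed.

Lemma commute_zexpg g h e : commute h g -> commute h (zexpg g e).
Proof. by move=> c; case: e => n /=; [|apply: commuteV]; exact: commuteX. Qed.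

End IntegerPowers.

Definition gmorph (X Y : groupType) (f : X -> Y) := {morph f : x y / x * y}.

Section GroupMorphism.
Variables (X Y : groupType) (f : X -> Y).
Hypothesis fM : gmorph f.

Lemma gmorph1 : f 1 = 1.
Proof. by apply: (mulgI (f 1)); rewrite -fM !mulg1. Qed.

Lemma gmorphV x : f x^-1 = (f x)^-1.
Proof. by apply: (mulgI (f x)); rewrite -fM !mulgV gmorph1. Qed.

End GroupMorphism.

(** The displacement of [f] under [s] is unchanged by left translation along the [a i], so
    representatives of the finitely many orbits already realize every value. *)
Lemma finite_coarse_equivariant (X Y : groupType) (I : Type) (a : I -> X) (b : I -> Y)
    (f : X -> Y) (l : seq X) :
  (forall i x, f (a i * x) = b i * f x) ->
  (forall x, exists i, exists2 y, y \in l & x = a i * y) -> coarse f.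
Proof.
move=> fab al s.
apply: (@sub_finite_set _ _ ((fun x => (f x)^-1 * f (x * s)) @` [set` l])%classic).
  move=> _ [x _ <-] /=; have [i [y yl ->]] := al x; exists y => //.
  by rewrite -mulgA !fab invgM -mulgA mulKg.
by apply: finite_image; exact: finite_seq.
Qed.

Section Lattice.

Definition lnorm := fix lnorm r : lattice r -> nat :=
  match r with
  | 0 => fun _ => 0
  | r'.+1 => fun v => maxn (lnorm r' v.1) `|v.2 : int|
  end.

Lemma lnorm1 r : lnorm (1 : lattice r) = 0.
Proof. by elim: r => //= r ->. Qed.

Lemma lnormM r (u v : lattice r) : (lnorm (u * v)%g <= lnorm u + lnorm v)%N.
Proof.
elim: r u v => //= r IH [u e] [v e'] /=; rewrite geq_max; apply/andP; split.
  apply: leq_trans (IH u v) _; apply: leq_add; exact: leq_maxl.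
have : (absz ((e : int) + (e' : int))%R <= absz e + absz e')%N by lia.
move/leq_trans; apply; apply: leq_add; exact: leq_maxr.
Qed.

Definition cube := fix cube r (n : nat) : seq (lattice r) :=
  match r with
  | 0 => [:: tt]
  | r'.+1 => [seq (v, (i%:Z - n%:Z)%R : zgroup) | v <- cube r' n, i <- iota 0 n.*2.+1]
  end.

Lemma cubeS r n : cube r.+1 n =
  [seq (v, (i%:Z - n%:Z)%R : zgroup) | v <- cube r n, i <- iota 0 n.*2.+1].
Proof. by []. Qed.

Lemma size_cube r n : size (cube r n) = (n.*2.+1 ^ r)%N.
Proof. by elim: r => // r IH; rewrite cubeS size_allpairs IH size_iota expnSr. Qed.

Lemma cube_uniq r n : uniq (cube r n).
Proof.
elim: r => // r IH; rewrite cubeS; apply: allpairs_uniq => //; first exact: iota_uniq.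
by move=> [u i] [v j] _ _ /= [-> /addIr [->]].
Qed.

Lemma mem_cube r n (v : lattice r) : (v \in cube r n) = (lnorm v <= n)%N.
Proof.
elim: r v => [[]|r IH [v e]] //.
have -> : lnorm ((v, e) : lattice r.+1) = maxn (lnorm v) (absz (e : int)) by [].
rewrite cubeS geq_max -IH.
apply/allpairsP/andP => [[[u i] /= [uc + [-> ->]]]|[vc en]].
  rewrite -/(iota 0 n.*2.+1) => iN; split=> //.
  by have := iN; rewrite mem_iota => /andP[_ ?]; lia.
exists (v, absz ((e : int) + n%:Z)%R); split=> //.
  by rewrite mem_iota [_.2]/=; lia.
congr pair; move: e en {IH}; rewrite /zgroup => e en; rewrite [_.2]/=.
by suff : (e = (absz (e + n%:Z))%:Z - n%:Z)%R; [|lia].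
Qed.

Lemma len_lattice r (G : groupType) (S : genset G) (f : lattice r -> G) :
  gmorph f -> exists C, forall v, (word_length S (f v) <= C * lnorm v)%N.
Proof.
elim: r f => [|r IH] f fM.
  by exists 0 => -[]; rewrite (gmorph1 fM) len1.
have [|C hC] := IH (fun v => f (v, 1)).
  by move=> u v; rewrite -fM; congr f; congr pair; rewrite mulg1.
pose t : lattice r.+1 := (1, 1%R : int).
have lenX g n : (word_length S (g ^+ n)%g <= n * word_length S g)%N.
  elim: n => [|n IHn]; first by rewrite len1.
  by rewrite expgS mulSn; apply: leq_trans (lenM _ _ _) _; rewrite leq_add2l.
have tZ (e : int) : ((1, e) : lattice r.+1) = zexpg t e.
  have tn (n : nat) : ((1, Posz n) : lattice r.+1) = t ^+ n.
    elim: n => [//|n IHn]; rewrite expgS -IHn.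
    change (((1, Posz n.+1) : lattice r.+1) = (1 * 1, (1 + Posz n)%R)).
    by rewrite mulg1 -PoszD add1n.
  case: e => n; rewrite [RHS]/= -tn //.
  change (((1, Negz n) : lattice r.+1) = (1^-1, (- Posz n.+1)%R)).
  by rewrite invg1.
exists (C + word_length S (f t))%N => -[v e] /=.
have -> : (v, e) = ((v, 1) : lattice r.+1) * zexpg t e.
  by rewrite -tZ; congr pair; rewrite ?mulg1 ?mul1g.
rewrite fM; apply: leq_trans (lenM _ _ _) _; rewrite mulnDl; apply: leq_add.
  by apply: leq_trans (hC v) _; rewrite leq_mul2l leq_maxl orbT.
have fX g n : f (g ^+ n) = f g ^+ n.
  by elim: n => [|n IHn]; rewrite ?(gmorph1 fM) // !expgS fM IHn.
rewrite mulnC; apply: (@leq_trans (`|e : int| * word_length S (f t))%N); last first.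
  by rewrite leq_mul2r leq_maxr orbT.
case: e => n /=; rewrite ?(gmorphV fM) fX; first exact: lenX.
by apply: leq_trans (lenV _ _) _; exact: lenX.
Qed.

End Lattice.

(** * Virtually abelian groups *)

Lemma exponent_le p q D : (forall n, 0 < n -> n ^ p <= D * n ^ q)%N -> p <= q.
Proof.
move=> le; rewrite leqNgt; apply/negP => qp; have := le D.+1 isT.
apply/negP; rewrite -ltnNge; apply: (@leq_trans (D.+1 ^ q.+1)%N).
  by rewrite expnS ltn_pmul2r // expn_gt0.
by rewrite leq_pexp2l.
Qed.

Section VirtuallyAbelian.
Variables (G : groupType) (S : genset G) (a c : nat).
Hypothesis c0 : 0 < c.
Hypothesis growth : forall r, 0 < r ->
  (r ^ a <= c * #|` ball S r| /\ #|` ball S r| <= c * r ^ a)%N.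

(** The image of a cube of side about n, with at least n^r points, lies in a ball of radius O(n),
    which has O(n^a) elements. *)
Lemma lattice_rank_le r (i : lattice r -> G) :
  gmorph i -> injective i -> r <= a.
Proof.
move=> iM iI; have [C hC] := len_lattice S iM.
apply: (@exponent_le _ _ (c * C.+1 ^ a)%N) => n n0.
apply: (@leq_trans (size (cube r n))).
  by rewrite size_cube; apply: leq_expl; lia.
apply: (@leq_trans #|` ball S (C.+1 * n)|).
  apply: (@leq_size_inj _ _ _ _ i); first exact: cube_uniq.
    by move=> u v _ _; exact: iI.
  move=> v; rewrite mem_cube mem_ball => vn; apply: leq_trans (hC v) _.
  exact: leq_mul.
by rewrite -mulnA -expnMn; apply: (growth _).2; rewrite muln_gt0.
Qed.

(** Dual count: recentred at [f 1], a ball of radius n injects into a cube with O(n^r) points. *)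
Lemma growth_le_rank r (f : G -> lattice r) (g : lattice r -> G) :
  cancel f g -> coarse f -> a <= r.
Proof.
move=> fK cf; have [C hC] := coarse_subadditive S (@lnorm1 r) (@lnormM r) cf.
apply: (@exponent_le _ _ (c * (C.*2.+1) ^ r)%N) => n n0.
apply: leq_trans (growth n0).1 _; rewrite -mulnA leq_mul2l; apply/orP; right.
apply: (@leq_trans (size (cube r (C * n)))); last first.
  by rewrite size_cube -expnMn; apply: leq_expl; nia.
apply: (@leq_size_inj _ _ _ _ (fun x => (f 1)^-1 * f x)); first exact: fset_uniq.
  by move=> u v _ _ /mulgI/(can_inj fK).
move=> x; rewrite mem_cube mem_ball => xn; apply: leq_trans (hC 1 x) _.
by rewrite invg1 mul1g leq_mul2l xn orbT.
Qed.

Section Rank.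
Variable K : {pred G}.
Hypotheses (Kgroup : group_closed K) (Kab : {in K &, forall x y, commute x y}).

Let K1 : 1 \in K. Proof. by case: Kgroup. Qed.
Let KV x : x \in K -> x^-1 \in K. Proof. exact: group_closedV. Qed.
Let KM x y : x \in K -> y \in K -> x * y \in K.
Proof. exact: (group_closedM Kgroup). Qed.
Let KX x n : x \in K -> x ^+ n \in K.
Proof. by move=> Kx; elim: n => // n IH; rewrite expgS KM. Qed.

Let embeds r (i : lattice r -> G) :=
  [/\ gmorph i, injective i & forall v, i v \in K].

(** An element of [K] with no positive power in the lattice commutes with it and generates a new
    independent direction. *)
Lemma embeds_extend r (i : lattice r -> G) g : embeds i -> g \in K ->
  (forall d v, 0 < d -> g ^+ d <> i v) ->
  exists j : lattice r.+1 -> G, embeds j.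
Proof.
move=> [iM iI iK] gK gfree.
have cg e v : commute (i v) (zexpg g e) by apply: commute_zexpg; exact: Kab.
pose j (x : lattice r.+1) := i x.1 * zexpg g x.2.
have jM : gmorph j.
  move=> [u e] [v e']; rewrite /j [_.1]/= [_.2]/= iM zexpgD -!mulgA; congr (_ * _).
  by rewrite !mulgA -(cg e v).
exists j; split=> //; last first.
  by move=> [v [n|n]]; rewrite /j /= KM // ?KV // KX.
have jK x : j x = 1 -> x = 1.
  case: x => [v [[|n]|n]]; rewrite /j /= ?mulg1.
  - by rewrite -(gmorph1 iM) => /iI ->.
  - by move=> /mulg1_eq; rewrite -(gmorphV iM) => /esym/gfree [].
  - move=> /(canRL (mulgVK _)); rewrite mul1g => /esym.
    by move/gfree => [].
move=> x y exy; apply: (mulIg y^-1); rewrite mulgV; apply: jK.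
by rewrite jM (gmorphV jM) exy mulgV.
Qed.

(** Growth bounds the rank of embedded lattices, so some lattice admits no extension; every element
    of [K] then has a positive power in it. *)
Lemma max_rank : exists r (i : lattice r -> G), embeds i /\
  forall g, g \in K -> exists2 d, 0 < d & exists v, g ^+ d = i v.
Proof.
apply: contrapT => no.
have all r : exists i : lattice r -> G, embeds i.
  elim: r => [|r [i emb]].
    by exists (fun=> 1); split=> // [u v|[] []//]; rewrite mulg1.
  apply: contrapT => noj; apply: no; exists r, i; split=> // g gK.
  apply: contrapT => nod; apply: noj; apply: (embeds_extend emb gK) => d v d0 gd.
  by apply: nod; exists d => //; exists v.
have [i [iM iI _]] := all a.+1.
by have := lattice_rank_le iM iI; rewrite ltnn.
Qed.

(* Words in the torsion classes of a finite set Q reduce to finitely many monomials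
   modulo the lattice. *)
Lemma torsion_monomials r (i : lattice r -> G) (Q : seq G) : embeds i ->
  {in Q, forall g, g \in K /\ exists2 d, 0 < d & exists v, g ^+ d = i v} ->
  exists2 M : seq G, 1 \in M /\ {subset M <= K} &
    {in Q & M, forall g m, exists2 m', m' \in M & exists v, g * m = m' * i v}.
Proof.
move=> [iM iI iK]; elim: Q => [|q Q IH] QK.
  by exists [:: 1] => //; split; [rewrite inE | move=> m; rewrite inE => /eqP ->].
have [|M [M1 MK] MQ] := IH; first by move=> g gQ; apply: QK; rewrite inE gQ orbT.
have [qK [d d0 [w qd]]] := QK q (mem_head _ _).
exists [seq q ^+ n * m | n <- iota 0 d, m <- M].
  split; first by apply/allpairsP; exists (0, 1); rewrite mem_iota M1 mulg1.
  by move=> _ /allpairsP[[n m] /= [_ /MK mK ->]]; rewrite KM // KX.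
move=> g _ /[swap] /allpairsP[[n m] /= [+ mM ->]]; rewrite mem_iota add0n => /andP[_ nd].
rewrite inE => /orP[/eqP->|gQ].
  have [nd'|nd'] := ltnP n.+1 d.
    exists (q ^+ n.+1 * m).
      by apply/allpairsP; exists (n.+1, m); rewrite mem_iota.
    by exists 1; rewrite (gmorph1 iM) mulg1 expgS mulgA.
  have dn : d = n.+1 by apply/eqP; rewrite eqn_leq nd' nd.
  exists m; first by apply/allpairsP; exists (0, m); rewrite mem_iota mul1g d0.
  have cw : commute (i w) m by apply: Kab; [exact: iK | exact: MK].
  by exists w; rewrite mulgA -expgS -dn qd cw.
have [m' m'M [v gm]] := MQ g m gQ mM.
have gK : g \in K by have [] := QK g; rewrite ?inE ?gQ ?orbT.
exists (q ^+ n * m').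
  by apply/allpairsP; exists (n, m'); rewrite mem_iota nd.
have cg : commute g (q ^+ n) by apply: Kab; [|exact: KX].
by exists v; rewrite mulgA cg -!mulgA gm.
Qed.

(** Schreier's argument: pushing a representative of a coset of [K] through a word leaves a product
    of elements of the finite set [Q] of [K], and [torsion_monomials] reduces it to one of finitely
    many monomials times a lattice element. *)
Lemma finite_coset_cover r (i : lattice r -> G) : embeds i ->
  (forall g, g \in K -> exists2 d, 0 < d & exists v, g ^+ d = i v) ->
  finite_set (range (fun g : G => [set h : G | g^-1 * h \in K]%classic)) ->
  exists L : seq G, forall g, exists v, exists2 y, y \in L & g = i v * y.
Proof.
move=> emb tors Kfin; have [iM iI iK] := emb.
have [ts tsP] : exists ts : seq G, forall g, exists2 t, t \in ts & t^-1 * g \in K.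
  have /finite_seqP[Cs CsP] := Kfin.
  exists (map (fun C : set G => xget 1 C) Cs) => g.
  pose C := [set h : G | g^-1 * h \in K]%classic.
  have CC : C \in Cs.
    by have : range (fun g : G => [set h : G | g^-1 * h \in K]%classic) C;
      [exists g | rewrite CsP].
  exists (xget 1 C); first exact: map_f.
  case: xgetP => [y _|/(_ g)]; last by rewrite /C /= mulVg K1.
  by rewrite /C /= => /KV; rewrite invgM invgK.
(* The Schreier elements t'^-1 s t that fall in [K]. *)
pose Q := [seq q <- [seq t.2^-1 * (s * t.1) | s <- letters S, t <- allpairs pair ts ts] | q \in K].
have [|M [M1 MK] MQ] := @torsion_monomials r i Q emb.
  by move=> q; rewrite mem_filter => /andP[qK _]; split; [|exact: tors].
have [t0 t0ts _] := tsP 1.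
have cover w : is_word S w -> exists2 t, t \in ts & exists2 m, m \in M &
    exists v, \prod_(s <- w) s * t0 = t * (m * i v).
  elim: w => [|s w IH] /=.
    by move=> _; exists t0 => //; exists 1 => //; exists 1; rewrite big_nil (gmorph1 iM) !mulg1 mul1g.
  move=> /andP[sS /IH[t tts [m mM [v e]]]].
  have [t' t'ts qK] := tsP (s * t).
  exists t' => //.
  have qQ : t'^-1 * (s * t) \in Q.
    rewrite mem_filter qK; apply/allpairsP; exists (s, (t, t')) => /=.
    by rewrite lettersP sS; split=> //; apply/allpairsP; exists (t, t').
  have [m' m'M [v' qm]] := MQ _ _ qQ mM; exists m' => //; exists (v' * v).
  by rewrite big_cons -mulgA e iM [m' * _]mulgA -qm !mulgA mulgV mul1g.
exists [seq (t * m)^-1 | t <- ts, m <- M] => g.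
(* [cover] puts the lattice element on the right; applied to the inverse of [g], with [t0]
   compensated, it yields the lattice element on the left. *)
have [w [Sw _ wg]] := len_spell S (g^-1 * t0^-1).
have [t tts [m mM [v e]]] := cover w Sw.
exists v^-1, (t * m)^-1; first by apply/allpairsP; exists (t, m).
by rewrite (gmorphV iM) -invgM -mulgA -e wg mulgVK invgK.
Qed.

End Rank.

Lemma distinct_cosets r (i : lattice r -> G) (L : seq G) : gmorph i ->
  exists2 L' : seq G, uniq L' /\ {in L' &, forall y y', forall v, y = i v * y' -> y = y'} &
    {in L, forall y, exists v, exists2 y', y' \in L' & y = i v * y'}.
Proof.
move=> iM; elim: L => [|y L [L' [uL' dL'] cL']]; first by exists [::].
have [[v [y' y'L' yy']]|no] := pselect (exists v, exists2 y', y' \in L' & y = i v * y').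
  exists L' => // z; rewrite inE => /orP[/eqP->|/cL'//].
  by exists v, y'.
exists (y :: L'); first split.
- rewrite /= uL' andbT; apply/negP => yL'; apply: no; exists 1, y => //.
  by rewrite (gmorph1 iM) mul1g.
- move=> z z'; rewrite !inE => /orP[/eqP->|zL'] /orP[/eqP->|z'L'] v // e.
  + by case: no; exists v, z'.
  + case: no; exists v^-1, z => //; by rewrite e (gmorphV iM) mulKg.
  + exact: dL' e.
move=> z; rewrite inE => /orP[/eqP->|/cL'[v [y' y'L' e]]].
  by exists 1, y; rewrite ?mem_head // (gmorph1 iM) mul1g.
by exists v, y'; rewrite // inE y'L' orbT.
Qed.

End VirtuallyAbelian.

(* v |-> i(v', e div q) y_(e mod q) for v = (v', e) and q cosets: the index of the coset
   is absorbed in the last coordinate. *)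
Lemma lattice_cosets_equivalent (G : groupType) r (i : lattice r.+1 -> G) (L : seq G) :
  gmorph i -> injective i ->
  uniq L -> {in L &, forall y y', forall v, y = i v * y' -> y = y'} ->
  (forall g, exists v, exists2 y, y \in L & g = i v * y) ->
  coarsely_equivalent G (lattice r.+1).
Proof.
move=> iM iI uL dL cL; pose q := size L.
have q0 : 0 < q.
  have [_ [y yL _]] := cL 1.
  by rewrite lt0n size_eq0; apply: contraTneq yL => ->.
have [dec decP] : exists dec : G -> lattice r.+1 * G,
    forall g, (dec g).2 \in L /\ g = i (dec g).1 * (dec g).2.
  have /choice[dec decP] : forall g, exists p : lattice r.+1 * G, p.2 \in L /\ g = i p.1 * p.2.
    by move=> g; have [v [y yL gE]] := cL g; exists (v, y).
  by exists dec.
have decE v y : y \in L -> dec (i v * y) = (v, y).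
  move=> yL; have [d2 dE] := decP (i v * y); move: (dec _) d2 dE => [u z] /= zL e.
  have yz : y = i (v^-1 * u) * z by rewrite iM (gmorphV iM) -mulgA -e mulKg.
  have ezy := dL _ _ yL zL _ yz; rewrite ezy; congr pair.
  by apply: iI; apply: (mulIg z); rewrite -e ezy.
pose f (x : G) : lattice r.+1 :=
  ((dec x).1.1, ((dec x).1.2 * q%:Z + (index (dec x).2 L)%:Z)%R : zgroup).
pose g (v : lattice r.+1) : G :=
  i (v.1, divz v.2 q : zgroup) * nth 1 L (absz (modz v.2 q)).
have fK : cancel f g.
  move=> x; have [yL xE] := decP x; rewrite /g /f [_.1]/= [_.2]/=.
  have jq : index (dec x).2 L < q by rewrite index_mem.
  have -> : divz (((dec x).1.2 : int) * q%:Z + (index (dec x).2 L)%:Z)%R q = (dec x).1.2.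
    by rewrite divzMDl ?divz_small ?addr0 //; lia.
  have -> : modz (((dec x).1.2 : int) * q%:Z + (index (dec x).2 L)%:Z)%R q = index (dec x).2 L.
    by rewrite modzMDl modz_small //; lia.
  by rewrite nth_index // -[X in i X]surjective_pairing -xE.
have gK : cancel g f.
  move=> [v e]; rewrite /f /g [_.1]/= [_.2]/=.
  have eq_lt : absz (modz e q) < q.
    by have := @modz_ge0 e q; have := @ltz_pmod e q; lia.
  rewrite decE ?mem_nth // [_.1]/= [_.2]/= index_uniq //; congr pair.
  have := divz_eq e q; have := @modz_ge0 e q.
  suff : (0 <= modz e q)%R -> (e = divz e q * q%:Z + modz e q)%R ->
    (divz e q * q%:Z + (absz (modz e q))%:Z)%R = (e : int).
    by move=> h h1 h2; apply: h h2; apply: h1; lia.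
  by move=> h1 h2; rewrite [RHS]h2 gez0_abs.
(* Left multiplication by [i v] becomes translation by [T v], which moves the last coordinate by a
   multiple of [q] and so preserves the coset index. *)
pose T (v : lattice r.+1) : lattice r.+1 := (v.1, ((v.2 : int) * q%:Z)%R : zgroup).
have fT v x : f (i v * x) = T v * f x.
  have [yL xE] := decP x; rewrite {1}xE mulgA -iM /f decE //.
  change ((v.1 * (dec x).1.1, (((v.2 : int) + (dec x).1.2) * q%:Z + (index (dec x).2 L)%:Z)%R) =
    (v.1 * (dec x).1.1, (v.2 * q%:Z + ((dec x).1.2 * q%:Z + (index (dec x).2 L)%:Z))%R)
    :> lattice r * int).
  by rewrite mulrDl addrA.
exists f, g; split=> //; first exact: (finite_coarse_equivariant fT cL).
apply: (@finite_coarse_equivariant _ _ _ T i g (map f L)) => [v x|x].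
  by rewrite -{1}[x]gK -fT fK.
have [v [y yL e]] := cL (g x).
by exists v, (f y); [exact: map_f | rewrite -fT -e gK].
Qed.

Theorem virtually_abelian_lattice (R : realType) (G : groupType) a :
  infinite_set [set: G] -> virtually_abelian G -> growth_degree G R a ->
  coarsely_equivalent G (lattice a).
Proof.
move=> infG [K [Kgroup Kab Kfin]] /growth_degree_nat[S [c [c0 growth]]].
have [r [i [emb tors]]] := max_rank c0 growth Kgroup Kab.
have [L0 cL0] := finite_coset_cover S Kgroup Kab emb tors Kfin.
have [iM iI _] := emb.
have [L [uL dL] cL] := distinct_cosets L0 iM.
have cover g : exists v, exists2 y, y \in L & g = i v * y.
  have [v [y yL0 ->]] := cL0 g; have [w [z zL ->]] := cL y yL0.
  by exists (v * w), z => //; rewrite iM mulgA.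
(* Rank 0 would make [G] a finite union of single points; a positive rank provides the coordinate
   that absorbs the cosets. *)
case: r => [|r] in i emb tors iM iI cL0 dL cL cover *.
  case: infG; apply: sub_finite_set (finite_seq L) => g _ /=.
  by have [[] [y yL ->]] := cover g; rewrite (gmorph1 iM) mul1g.
have eqv := lattice_cosets_equivalent iM iI uL dL cover.
have [f [g [fK _ cf _]]] := eqv.
(* The rank is at most [a] by the embedding of the lattice, and at least [a] by the coarse injection
   of [G] into it. *)
have ar : a = r.+1.
  apply/eqP; rewrite eqn_leq (lattice_rank_le c0 growth iM iI) andbT.
  exact: (growth_le_rank c0 growth fK cf).
by rewrite ar.
Qed.

(** * Iterated lampshufflers *)

Section IteratedShuffler.
Variables (R : realType) (A : groupType) (a : nat).
Hypotheses (A_infinite : infinite_set [set: A]) (A_growth : growth_degree A R a).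

Lemma iter_Shuffler_nontrivial n : exists s : iter n Shuffler A, s != 1.
Proof.
elim: n => [|n [s s1]].
  apply: contrapT => no; apply: A_infinite; apply: sub_finite_set (finite_set1 1) => x _ /=.
  by apply: contrapT => /eqP x1; apply: no; exists x.
by exists (arr s); apply: contra_neq s1 => /(congr1 (@arrow _)).
Qed.

Lemma folner_lower_iter_Shuffler n : folner_lower (iter n Shuffler A) (low_tower a n).
Proof.
elim: n => [|n IH].
  have [S [c [c0 growth]]] := growth_degree_nat A_growth.
  exact: folner_lower_growth c0 growth.
have [s s1] := iter_Shuffler_nontrivial n.
exact: folner_lower_Shuffler s1 IH.
Qed.

Lemma folner_upper_iter_Shuffler n : folner_upper (iter n Shuffler A) (up_tower a n).
Proof.
elim: n => [|n IH]; last exact: folner_upper_Shuffler IH.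
have [S [c [c0 growth]]] := growth_degree_nat A_growth.
exact: folner_upper_growth c0 growth (growth_degree_gt0 A_infinite A_growth).
Qed.

End IteratedShuffler.

(** The lower tower of the source must stay below a multiple of the upper tower of the target. The
    upper bound for the source supplies the amenability required by the averaging. *)
Lemma iter_Shuffler_coarse_le (R : realType) (n m : nat) (A B : groupType) (a b : nat)
    (f : iter n Shuffler A -> iter m Shuffler B) :
  infinite_set [set: A] -> infinite_set [set: B] ->
  growth_degree A R a -> growth_degree B R b -> coarse f -> bounded_fibers f ->
  n < m \/ n = m /\ a <= b.
Proof.
move=> infA infB grA grB cf bf.
have [M up] := folner_upper_coarse cf bf (@folner_upper_iter_Shuffler R A a infA grA n)
  (@folner_upper_iter_Shuffler R B b infB grB m).
have [L [C C0 low]] := @folner_lower_iter_Shuffler R A a infA grA n.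
have [D D0 {}up] := up L.
apply: (@tower_le _ _ _ _ (D * C)%N M (growth_degree_gt0 infA grA)) => k k0.
have [|U fU UM] := up (C * k)%N; first by rewrite muln_gt0 C0.
by rewrite -mulnA; apply: leq_trans UM; exact: low.
Qed.

Theorem corollaryI (R : realType) (n m : nat) (A B : groupType) (a b : nat)
  (A_infinite : infinite_set [set: A]) (B_infinite : infinite_set [set: B])
  (A_fg : finitely_generated A) (B_fg : finitely_generated B)
  (A_vab : virtually_abelian A) (B_vab : virtually_abelian B)
  (A_growth : growth_degree A R a) (B_growth : growth_degree B R b)
  (S : genset (iter n Shuffler A)) (T : genset (iter m Shuffler B)) :
  let dS := word_dist R S in
  let dT := word_dist R T in
  [<-> quasi_isometric dS dT;
       n = m /\ a = b;
       biLipschitz_equivalent dS dT] /\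
  ([/\ quasi_isometric dS dT,
       n = m /\ a = b &
       biLipschitz_equivalent dS dT] <->
   (exists f : iter n Shuffler A -> iter m Shuffler B, regular_map dS dT f) /\
   (exists g : iter m Shuffler B -> iter n Shuffler A, regular_map dT dS g)).
Proof.
move=> dS dT.
(* Both quasi-isometries and pairs of regular maps provide these two hypotheses; the two
   lexicographic inequalities, one from each direction, then force equality. *)
have rigid : (exists f : iter n Shuffler A -> iter m Shuffler B, coarse f /\ bounded_fibers f) ->
    (exists g : iter m Shuffler B -> iter n Shuffler A, coarse g /\ bounded_fibers g) ->
    n = m /\ a = b.
  move=> [f [cf bf]] [g [cg bg]].
  have := iter_Shuffler_coarse_le A_infinite B_infinite A_growth B_growth cf bf.
  have := iter_Shuffler_coarse_le B_infinite A_infinite B_growth A_growth cg bg.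
  by lia.
have qi_eq : quasi_isometric dS dT -> n = m /\ a = b.
  by move=> /quasi_isometric_coarse[]; exact: rigid.
have eq_coarse : n = m /\ a = b ->
    coarsely_equivalent (iter n Shuffler A) (iter m Shuffler B).
  move=> [<- ab]; apply: coarsely_equivalent_iter_Shuffler.
  apply: coarsely_equivalent_trans (virtually_abelian_lattice A_infinite A_vab A_growth) _.
  apply: coarsely_equivalent_sym; rewrite ab.
  exact: virtually_abelian_lattice B_infinite B_vab B_growth.
have eq_biLip : n = m /\ a = b -> biLipschitz_equivalent dS dT.
  by move=> /eq_coarse; exact: coarsely_equivalent_biLipschitz.
have biLip_qi : biLipschitz_equivalent dS dT -> quasi_isometric dS dT.
  by move=> [f [qf _]]; exists f.
split; first by tfae.
split=> [[_ /eq_coarse[f [g [fK gK cf cg]]] _]|[[f rf] [g rg]]].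
  by split; [exists f | exists g]; apply: coarse_regular; eassumption.
have nm : n = m /\ a = b.
  by apply: rigid; [exists f | exists g]; apply: regular_coarse; eassumption.
by split=> //; [apply: biLip_qi|]; exact: eq_biLip.
Qed.
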